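(* Let $E: y^2+xy=x^3+x^2-2x$ over $\mathbb{Q}$ and $P=(2,2)\in E(\mathbb{Q})$. Let $r\ge1$, let $K_r$ be the field generated over $\mathbb{Q}$ by the $x$- and $y$-coordinates of all points $\beta\in E(\mathbb{C})$ with $2^r\beta=P$. Fix a basis $A,B$ of $E[2^r]$ and a point $\beta_r\in E(\mathbb{C})$ with $2^r\beta_r=P$. For $\sigma\in\mathrm{Gal}(K_r/\mathbb{Q})$ write $\sigma(A)=aA+bB$, $\sigma(B)=cA+dB$, $\sigma(\beta_r)=\beta_r+eA+fB$ with $a,b,c,d,e,f\in\mathbb{Z}/2^r\mathbb{Z}$, and set $M=\begin{bmatrix}a&b\\c&d\end{bmatrix}$, $\vec v=\begin{bmatrix}e&f\end{bmatrix}$ (a row vector). Let $p\notin\{2,3,17\}$ be prime, let $\mathfrak{p}$ be a prime of $K_r$ above $p$, let $\sigma$ be the Artin symbol (Frobenius) of $\mathfrak{p}$ in $\mathrm{Gal}(K_r/\mathbb{Q})$, with associated $(\vec v,M)$, and assume $\det(I-M)\not\equiv 0\pmod{2^r}$. Then for every integer $h\ge0$, the reduction of $2^hP$ has odd order in $E(\mathbb{F}_p)$ if and only if $2^h\vec v$ lies in the image of $I-M$, i.e. there is a row vector $\vec x\in(\mathbb{Z}/2^r\mathbb{Z})^2$ with $\vec x(I-M)=2^h\vec v$.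
   Context: $E[2^r]$ denotes the group of points of $E(\mathbb{C})$ of order dividing $2^r$; it is isomorphic to $(\mathbb{Z}/2^r\mathbb{Z})^2$ and its coordinates lie in $K_r$, which is Galois over $\mathbb{Q}$. The only primes ramifying in $K_r$ are among $2,3,17$, and $E$ has good reduction outside $\{2,3,17\}$. *)

(* Defs.v *)
From HB Require Import structures.
From mathcomp Require Import all_boot all_order all_algebra.
From mathcomp Require Import complex.
From mathcomp Require Import boolp classical_sets reals.
Set Implicit Arguments.
Unset Strict Implicit.
Unset Printing Implicit Defensive.
Import Order.TTheory GRing.Theory Num.Theory.
Local Open Scope ring_scope.

(* The projective curve E : y^2 + x y = x^3 + x^2 - 2 x.  A point is either
   [None], the point at infinity and neutral element, or an affine pair. *)
Definition Epoint (F : Type) : Type := option (F * F).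

Definition on_curve (F : fieldType) (Q : Epoint F) : Prop :=
  if Q is Some (x, y) then y ^+ 2 + x * y = x ^+ 3 + x ^+ 2 - 2%:R * x
  else True.

Section GroupLaw.
Variable F : fieldType.

(* Chord and tangent law for a1 = a2 = 1, a3 = a6 = 0, a4 = -2.  The opposite
   of (x, y) is (x, - y - x); if l is the slope of the chord or tangent, the
   third intersection point has abscissa x3 = l^2 + l - 1 - x1 - x2, and the
   sum is the opposite of that point. *)
Definition addp (Q1 Q2 : Epoint F) : Epoint F :=
  match Q1, Q2 with
  | None, _ => Q2
  | _, None => Q1
  | Some (x1, y1), Some (x2, y2) =>
    if (x1 == x2) && (y2 == - y1 - x1) then None
    else
      let l := if x1 == x2
               then (3%:R * x1 ^+ 2 + 2%:R * x1 - 2%:R - y1) / (2%:R * y1 + x1)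
               else (y2 - y1) / (x2 - x1) in
      let x3 := l ^+ 2 + l - 1 - x1 - x2 in
      Some (x3, - (y1 + l * (x3 - x1)) - x3)
  end.

Definition mulp (n : nat) (Q : Epoint F) : Epoint F := iter n (addp Q) None.

Definition lincomb (m n : nat) (A B : Epoint F) : Epoint F :=
  addp (mulp m A) (mulp n B).

Definition ptP : Epoint F := Some (2%:R, 2%:R).

Definition has_order (Q : Epoint F) (n : nat) : Prop :=
  [/\ (0 < n)%N, mulp n Q = None
    & forall m : nat, (0 < m < n)%N -> mulp m Q <> None].

Definition has_odd_order (Q : Epoint F) : Prop :=
  exists2 n : nat, has_order Q n & odd n.

Definition torsion (n : nat) (T : Epoint F) : Prop :=
  on_curve T /\ mulp n T = None.

(* [A, B] is a basis of E[n] over Z/nZ (for 1 < n, as 'Z_0 and 'Z_1 are Z/2Z);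
   the coefficients act through their representatives in {0, ..., n - 1}. *)
Definition torsion_basis (n : nat) (A B : Epoint F) : Prop :=
  [/\ torsion n A, torsion n B
    & forall T, torsion n T ->
      exists! ab : 'Z_n * 'Z_n, T = lincomb ab.1 ab.2 A B].

End GroupLaw.

Definition map_point (F G : Type) (f : F -> G) (Q : Epoint F) : Epoint G :=
  omap (fun xy => (f xy.1, f xy.2)) Q.

(* Reduction E(Q) -> E(F_p).  The equation being integral, the coordinates of
   an affine rational point are (a / d^2, b / d^3) in lowest terms; if p
   divides d the primitive projective coordinates (a d : b : d^3) reduce to
   the point at infinity. *)
Definition redp (p : nat) (Q : Epoint rat) : Epoint 'F_p :=
  if Q is Some (x, y) then
    if (p%:Z %| denq x)%Z || (p%:Z %| denq y)%Z then None
    else Some (ratr x, ratr y)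
  else None.

Section DivisionField.
Variables (R : realType) (r : nat).

Definition division_point (b : Epoint R[i]) : Prop :=
  on_curve b /\ mulp (2 ^ r) b = ptP R[i].

Definition division_coordinate : set R[i] :=
  [set z | exists x y, division_point (Some (x, y)) /\ (z = x \/ z = y)].

(* A subfield of R[i] automatically contains Q. *)
Definition subfield (S : set R[i]) : Prop :=
  [/\ S 1, forall x y, S x -> S y -> S (x - y)
    & forall x y, S x -> S y -> S (x / y)].

Definition in_Kr : pred R[i] :=
  fun z => `[< smallest subfield division_coordinate z >].

Lemma in_Kr_divring : divring_closed in_Kr.
Proof.
split; rewrite /in_mem /=.
- by apply/asboolP => S [] [].
- move=> x y /asboolP xK /asboolP yK; apply/asboolP => S SP.
  by case: (SP) => -[_ SB _] _; apply: SB; [apply: xK | apply: yK].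
- move=> x y /asboolP xK /asboolP yK; apply/asboolP => S SP.
  by case: (SP) => -[_ _ SV] _; apply: SV; [apply: xK | apply: yK].
Qed.

HB.instance Definition _ :=
  GRing.isDivringClosed.Build R[i] in_Kr in_Kr_divring.

Record Kr : Type := MkKr { Kr_val :> R[i]; Kr_valP : in_Kr Kr_val }.

HB.instance Definition _ := [isSub for Kr_val].
HB.instance Definition _ := [Choice of Kr by <:].
HB.instance Definition _ := [SubChoice_isSubIntegralDomain of Kr by <:].
HB.instance Definition _ := [SubIntegralDomain_isSubField of Kr by <:].

Definition in_OKr : pred Kr := fun x => `[< integralOver (intr : int -> Kr) x >].

Lemma in_OKr_subring : subring_closed in_OKr.
Proof.
split; rewrite /in_mem /=.
- by apply/asboolP; exact: (integral1 (intr : {rmorphism int -> Kr})).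
- move=> x y /asboolP xO /asboolP yO; apply/asboolP.
  exact: (@integral_sub _ _ (intr : {rmorphism int -> Kr})).
- move=> x y /asboolP xO /asboolP yO; apply/asboolP.
  exact: (@integral_mul _ _ (intr : {rmorphism int -> Kr})).
Qed.

HB.instance Definition _ :=
  GRing.isSubringClosed.Build Kr in_OKr in_OKr_subring.

Record OKr : Type := MkOKr { OKr_val :> Kr; OKr_valP : in_OKr OKr_val }.

HB.instance Definition _ := [isSub for OKr_val].
HB.instance Definition _ := [Choice of OKr by <:].
HB.instance Definition _ := [SubChoice_isSubComNzRing of OKr by <:].

(* Field automorphisms of Kr; they fix the prime field Q. *)
Record galKr : Type := GalKr {
  gal_fun :> {rmorphism Kr -> Kr};
  gal_bij : bijective gal_fun }.

Lemma gal_integral (s : galKr) (x : OKr) : in_OKr (s (OKr_val x)).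
Proof.
case/asboolP: (OKr_valP x) => q q_monic qx0; apply/asboolP; exists q => //.
have -> : map_poly (intr : int -> Kr) q = map_poly s (map_poly intr q).
  by rewrite -map_poly_comp; apply: eq_map_poly => z /=; rewrite rmorph_int.
by rewrite rmorph_root.
Qed.

Definition gal_OKr (s : galKr) (x : OKr) : OKr := MkOKr (gal_integral s x).

Definition above (p : nat) (I : prime_idealr OKr) : Prop := p%:R \in I.

(* [s] is the Frobenius of [I], for [I] above p; it is unique when p is
   unramified in Kr. *)
Definition is_frobenius (p : nat) (I : prime_idealr OKr) (s : galKr) : Prop :=
  forall x : OKr, gal_OKr s x - x ^+ p \in I.

(* [s] maps [Q] to [Q'], for a complex point [Q] with coordinates in Kr. *)
Definition gal_maps (s : galKr) (Q Q' : Epoint R[i]) : Prop :=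
  exists2 T : Epoint Kr, map_point Kr_val T = Q
                      & map_point (fun z => Kr_val (s z)) T = Q'.

End DivisionField.

(* Main.v *)
(* Let k be the fraction field of OKr/I.  Everything takes place in E(k), whose
   group law (associativity included) is established by slope computations.
   A point whose double is I-integral is I-integral, because x satisfies a monic
   quartic over x(2Q) away from 2; hence beta and the points of E[2^r] have
   I-integral coordinates, and reducing them is additive and injective on
   E[2^r].  A and B thus reduce to a basis of E(k)[2^r], on which the p-power
   Frobenius phi of k acts by M, and phi moves the reduction of beta by v.

   If Q is a phi-fixed point with 2^r Q = 2^h P, then Q - 2^h beta is a torsion
   point x(A, B) with x (I - M) = 2^h v, and conversely.  If 2^h P has odd order
   such a Q exists among its multiples.  Conversely, det (I - M) <> 0 mod 2^r
   forces the phi-fixed 2-power torsion to be killed by 2^(r-1), so that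
   2^h P = 2^r Q has odd order. *)
Require Import Defs.
From HB Require Import structures.
From mathcomp Require Import all_boot all_order all_algebra all_field ring.
From mathcomp Require Import complex.
From mathcomp Require Import boolp reals.
Set Implicit Arguments.
Unset Strict Implicit.
Unset Printing Implicit Defensive.
Import Order.TTheory GRing.Theory Num.Theory.
Local Open Scope ring_scope.

(** * Associativity of the group law *)

Section ChordIdentities.
Variable F : fieldType.
Implicit Types c a b u v l : F.

(* Translating Q to the origin turns the curve into
   y^2 + x y + c y = x^3 + a x^2 + b x, with P = (u, l1 u) and R = (v, l3 v);
   s, w and t are the abscissae of P + Q, Q + R and (P + Q) + R.  The equations
   of P and R can be solved for a and b, which leaves rational identities in
   independent variables.  P = Q and Q = R are allowed; the three lemmas
   distinguish whether the outer additions are along chords or tangents. *)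
Lemma assoc_chord_chord c a u v l1 l3 l2 l4 :
  u != v ->
  l1 * (c + (l1 + 1) * u) - l3 * (c + (l3 + 1) * v) = (u - v) * (u + v + a) ->
  let s := l1 ^+ 2 + l1 - a - u in
  let w := l3 ^+ 2 + l3 - a - v in
  s != v -> w != u ->
  l2 * (v - s) = l3 * v + c + (l1 + 1) * s ->
  l4 * (u - w) = l1 * u + c + (l3 + 1) * w ->
  let t := l2 ^+ 2 + l2 - a - s - v in
  t = l4 ^+ 2 + l4 - a - w - u /\ l3 * v + l2 * (t - v) = l1 * u + l4 * (t - u).
Proof.
rewrite -subr_eq0 => uv H /=.
rewrite ![_ == v]eq_sym ![_ == u]eq_sym -![_ == _ - _]subr_eq0 => hs hw h2 h4.
have Ha : a = (l1 * (c + (l1 + 1) * u) - l3 * (c + (l3 + 1) * v)) / (u - v)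
              - (u + v) by rewrite H; field.
(* The denominators of both outer slopes factor, so [s != v] and [w != u] yield the nonvanishing
   facts that [field] requires. *)
have k1 : v - (l1 ^+ 2 + l1 - a - u)
        = (l1 - l3) * (c + (l1 + l3 + 1) * v) / (u - v) by rewrite Ha; field.
have k2 : u - (l3 ^+ 2 + l3 - a - v)
        = (l1 - l3) * (c + (l1 + l3 + 1) * u) / (u - v) by rewrite Ha; field.
move: hs hw h2 h4; rewrite k1 k2 !mulf_eq0 !negb_or.
move=> /andP[/andP[d1 d2] _] /andP[/andP[_ d3] _] h2 h4.
have -> : l2 = (l3 * v + c + (l1 + 1) * (l1 ^+ 2 + l1 - a - u))
               / ((l1 - l3) * (c + (l1 + l3 + 1) * v) / (u - v)).
  by rewrite -h2; field; rewrite ?uv ?d1 ?d2.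
have -> : l4 = (l1 * u + c + (l3 + 1) * (l3 ^+ 2 + l3 - a - v))
               / ((l1 - l3) * (c + (l1 + l3 + 1) * u) / (u - v)).
  by rewrite -h4; field; rewrite ?uv ?d1 ?d3.
by rewrite Ha; split; field; rewrite ?d1 ?uv ?d2 ?d3.
Qed.

Lemma assoc_tangent_chord c a b u v l1 l3 l2 l4 :
  u != v ->
  l1 * (c + (l1 + 1) * u) = u ^+ 2 + a * u + b ->
  l3 * (c + (l3 + 1) * v) = v ^+ 2 + a * v + b ->
  let s := l1 ^+ 2 + l1 - a - u in
  let w := l3 ^+ 2 + l3 - a - v in
  s = v -> l3 * v + c + (l1 + 1) * s = 0 -> w != u ->
  c + (2%:R * l3 + 1) * v != 0 ->
  l2 * (c + (2%:R * l3 + 1) * v) = 3%:R * v ^+ 2 + 2%:R * a * v + b - l3 * v ->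
  l4 * (u - w) = l1 * u + c + (l3 + 1) * w ->
  let t := l2 ^+ 2 + l2 - a - s - v in
  t = l4 ^+ 2 + l4 - a - w - u /\ l3 * v + l2 * (t - v) = l1 * u + l4 * (t - u).
Proof.
rewrite -subr_eq0 => uv H1 H3 /= hs; rewrite hs => hc hw d h2 h4.
(* Here P + Q = R, which determines [c] and [a]; the equation of P then gives [b], leaving [u], [v],
   [l1], [l3] as variables. *)
have Ec : c = - (l1 + l3 + 1) * v by apply/eqP; rewrite -subr_eq0 -hc; apply/eqP; ring.
have Ea : a = l1 ^+ 2 + l1 - u - v by rewrite -hs; ring.
have Eb : b = l1 * (c + (l1 + 1) * u) - u ^+ 2 - a * u by rewrite H1; ring.
have dE : c + (2%:R * l3 + 1) * v = (l3 - l1) * v by rewrite Ec; ring.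
have wE : u - (l3 ^+ 2 + l3 - a - v) = (l1 - l3) * (l1 + l3 + 1) by rewrite Ea; ring.
move: hw; rewrite eq_sym -subr_eq0 => hw.
move: hw d h2 h4; rewrite wE dE !mulf_eq0 !negb_or.
move=> /andP[d1 d2] /andP[d1' d3] h2 h4.
have -> : l2 = (3%:R * v ^+ 2 + 2%:R * a * v + b - l3 * v) / ((l3 - l1) * v).
  by rewrite -h2; field; rewrite ?d1' ?d3.
have -> : l4 = (l1 * u + c + (l3 + 1) * (l3 ^+ 2 + l3 - a - v))
                / ((l1 - l3) * (l1 + l3 + 1)).
  by rewrite -h4; field; rewrite ?d1 ?d2.
by rewrite Eb Ea Ec; split; field; rewrite ?d1 ?d1' ?d2 ?d3.
Qed.

Lemma assoc_tangent_tangent c a b u v l1 l3 l2 l4 :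
  u != v ->
  l1 * (c + (l1 + 1) * u) = u ^+ 2 + a * u + b ->
  l3 * (c + (l3 + 1) * v) = v ^+ 2 + a * v + b ->
  let s := l1 ^+ 2 + l1 - a - u in
  let w := l3 ^+ 2 + l3 - a - v in
  s = v -> l3 * v + c + (l1 + 1) * s = 0 ->
  w = u -> l1 * u + c + (l3 + 1) * w = 0 ->
  c + (2%:R * l3 + 1) * v != 0 -> c + (2%:R * l1 + 1) * u != 0 ->
  l2 * (c + (2%:R * l3 + 1) * v) = 3%:R * v ^+ 2 + 2%:R * a * v + b - l3 * v ->
  l4 * (c + (2%:R * l1 + 1) * u) = 3%:R * u ^+ 2 + 2%:R * a * u + b - l1 * u ->
  let t := l2 ^+ 2 + l2 - a - s - v in
  t = l4 ^+ 2 + l4 - a - w - u /\ l3 * v + l2 * (t - v) = l1 * u + l4 * (t - u).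
Proof.
rewrite -subr_eq0 => uv H1 H3 /= hs; rewrite hs => hc hw; rewrite hw => hc'.
move=> d d' h2 h4.
(* The conditions P + Q = R and Q + R = P differ by [(u - v) * (l1 + l3 + 1)]. They make Q a
   2-torsion point, whence [c = 0] below. *)
have E3 : l3 = - 1 - l1.
  have: (u - v) * (l1 + l3 + 1) = 0 by rewrite -[0](subrr 0) -{1}hc' -hc; ring.
  move/eqP; rewrite mulf_eq0 (negPf uv) /= => /eqP E.
  by apply/eqP; rewrite -subr_eq0 -E; apply/eqP; ring.
have Ec : c = 0 by rewrite -hc E3; ring.
have Ea : a = l1 ^+ 2 + l1 - u - v by rewrite -hs; ring.
have Eb : b = l1 * (c + (l1 + 1) * u) - u ^+ 2 - a * u by rewrite H1; ring.
have dE : c + (2%:R * l3 + 1) * v = - ((2%:R * l1 + 1) * v) by rewrite Ec E3; ring.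
have dE' : c + (2%:R * l1 + 1) * u = (2%:R * l1 + 1) * u by rewrite Ec; ring.
move: d d' h2 h4; rewrite dE dE' oppr_eq0 !mulf_eq0 !negb_or.
move=> /andP[d1 d2] /andP[_ d3] h2 h4.
have -> : l2 = (3%:R * v ^+ 2 + 2%:R * a * v + b - l3 * v)
               / (- ((2%:R * l1 + 1) * v)).
  by rewrite -h2; field; rewrite ?oppr_eq0 ?mulf_eq0 ?negb_or ?d1 ?d2.
have -> : l4 = (3%:R * u ^+ 2 + 2%:R * a * u + b - l1 * u)
               / ((2%:R * l1 + 1) * u).
  by rewrite -h4; field; rewrite ?d1 ?d3.
by rewrite Eb Ea Ec E3; split; field; rewrite ?oppr_eq0 ?mulf_eq0 ?negb_or ?d1 ?d2 ?d3.
Qed.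

End ChordIdentities.

(* The discriminant of the curve is a product of powers of 2, 3 and 17. *)
Definition nonsingular_char (F : fieldType) : bool := 102%:R != 0 :> F.

(** A certificate: once the cofactor [k] of a known equation is supplied, the goal is a [ring]
    identity. The next lemma combines two equations. *)
Lemma eq_of_lin (F : fieldType) (k A B X Y : F) :
  X = Y -> A - B = k * (X - Y) -> A = B.
Proof. by move=> ->; rewrite subrr mulr0 => /subr0_eq. Qed.

Lemma eq_of_lin2 (F : fieldType) (k k' A B X Y X' Y' : F) :
  X = Y -> X' = Y' -> A - B = k * (X - Y) + k' * (X' - Y') -> A = B.
Proof. by move=> -> ->; rewrite !subrr !mulr0 addr0 => /subr0_eq. Qed.

(** * Chords, tangents and the group axioms *)

Section Slopes.
Variable F : fieldType.
Implicit Types (x y l : F) (Q : Epoint F).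

Definition oppp Q : Epoint F := if Q is Some (x, y) then Some (x, - y - x) else None.

(* [l] is the slope of the chord, or of the tangent when both points agree;
   the second equation is the one that determines [l] in the tangent case. *)
Definition slope l x1 y1 x2 y2 : Prop :=
  l * (x2 - x1) = y2 - y1 /\
  l * (y1 + y2 + x1) =
    x1 ^+ 2 + x1 * x2 + x2 ^+ 2 + x1 + x2 - 2%:R - y2.

Definition third l x1 y1 x2 : F * F :=
  let x3 := l ^+ 2 + l - 1 - x1 - x2 in (x3, y1 + l * (x3 - x1)).

Definition opposite x1 y1 x2 y2 : bool := (x1 == x2) && (y2 == - y1 - x1).

Lemma oppp_inv Q : oppp (oppp Q) = Q.
Proof. by case: Q => [[x y]|] //=; congr (Some (_, _)); ring. Qed.

Lemma oppp_on_curve Q : on_curve Q -> on_curve (oppp Q).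
Proof. by case: Q => [[x y]|] //= H; apply: (eq_of_lin (k := 1) H); ring. Qed.

Lemma slope_sym l x1 y1 x2 y2 : slope l x1 y1 x2 y2 -> slope l x2 y2 x1 y1.
Proof.
case=> H1 H2; split; first by apply: (eq_of_lin (k := - 1) H1); ring.
by apply: (eq_of_lin2 (k := 1) (k' := 1) H1 H2); ring.
Qed.

Lemma slope_opp l x1 y1 x2 y2 :
  slope l x1 y1 x2 y2 -> slope (- l - 1) x1 (- y1 - x1) x2 (- y2 - x2).
Proof.
case=> H1 H2; split; first by apply: (eq_of_lin (k := - 1) H1); ring.
by apply: (eq_of_lin2 (k := 1) (k' := 1) H1 H2); ring.
Qed.

Lemma slope_third l x1 y1 x2 y2 (T := third l x1 y1 x2) :
  slope l x1 y1 x2 y2 -> slope l x1 y1 T.1 T.2.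
Proof.
case=> H1 H2; rewrite /T /=; split; first by ring.
by apply: (eq_of_lin2 (k := l + 1) (k' := 1) H1 H2); ring.
Qed.

Lemma third_sym l x1 y1 x2 y2 :
  slope l x1 y1 x2 y2 -> third l x1 y1 x2 = third l x2 y2 x1.
Proof.
case=> H1 H2; rewrite /third /=; congr pair; first by ring.
by apply: (eq_of_lin (k := 1) H1); ring.
Qed.

Lemma slope_on_curve l x1 y1 x2 y2 :
  slope l x1 y1 x2 y2 -> on_curve (Some (x1, y1)) -> on_curve (Some (x2, y2)).
Proof.
case=> H1 H2 /= H.
have E1 : y2 = y1 + l * (x2 - x1) by rewrite H1; ring.
rewrite E1 in H2 *.
by apply: (eq_of_lin2 (k := x2 - x1) (k' := 1) H2 H); ring.
Qed.

Lemma opposite_sym x1 y1 x2 y2 : opposite x1 y1 x2 y2 = opposite x2 y2 x1 y1.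
Proof.
rewrite /opposite [x2 == x1]eq_sym; case: eqP => //= ->.
by apply/eqP/eqP => ->; ring.
Qed.

Lemma on_curve_same_x x y1 y2 :
  on_curve (Some (x, y1)) -> on_curve (Some (x, y2)) ->
  y1 = y2 \/ y2 = - y1 - x.
Proof.
move=> /= H1 H2; have /eqP : (y1 - y2) * (y2 + y1 + x) = 0.
  by apply: (eq_of_lin2 (k := 1) (k' := - 1) H1 H2); ring.
rewrite mulf_eq0 => /orP[/eqP/subr0_eq|/eqP E]; first by left.
by right; apply: (eq_of_lin (k := 1) E); ring.
Qed.

Hypothesis charF : nonsingular_char F.

Lemma nonsingular_nat_neq0 n : (n %| 102)%N -> n%:R != 0 :> F.
Proof.
case/dvdnP => m E; apply: contraNneq charF => n0.
by rewrite -[102%:R]/((102%N)%:R) E natrM n0 mulr0.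
Qed.

(** The two expressions are the partial derivatives of the equation, up to sign. A singular point
    has either [x = 0], which gives 4 = 0, or [x ^+ 2 = -2] and [5 x = 16], which give 306 = 3 * 102
    = 0. *)
Lemma nonsingular x y : on_curve (Some (x, y)) -> 2%:R * y + x = 0 ->
  3%:R * x ^+ 2 + 2%:R * x - 2%:R - y != 0.
Proof.
move=> /= H Hy; apply: contraNneq charF => Hx.
have n2 := nonsingular_nat_neq0 (isT : 2 %| 102)%N.
have Hq : 6%:R * x ^+ 2 + 5%:R * x - 4%:R = 0.
  by apply: (eq_of_lin2 (k := 2%:R) (k' := 1) Hx Hy); ring.
have /eqP : x * (4%:R * x ^+ 2 + 5%:R * x - 8%:R) = 0.
  by apply: (eq_of_lin2 (k := - 4%:R) (k' := (2%:R * y + x)) H Hy); ring.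
rewrite mulf_eq0 => /orP[] /eqP E.
  have : 2%:R * 2%:R = 0 :> F by rewrite E in Hq; apply: (eq_of_lin (k := - 1) Hq); ring.
  by move/eqP; rewrite mulf_eq0 (negPf n2).
have E2 : x ^+ 2 = - 2%:R.
  have : 2%:R * (x ^+ 2 + 2%:R) = 0.
    by apply: (eq_of_lin2 (k := 1) (k' := - 1) Hq E); ring.
  by move/eqP; rewrite mulf_eq0 (negPf n2) /= addr_eq0 => /eqP.
have E3 : 5%:R * x = 16%:R by rewrite E2 in E; apply: (eq_of_lin (k := 1) E); ring.
have n3 := nonsingular_nat_neq0 (isT : 3 %| 102)%N.
have : 3%:R * 102%:R = 0 :> F.
  by apply: (eq_of_lin2 (k := - (5%:R * x + 16%:R)) (k' := 25%:R) E3 E2); ring.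
by move/eqP; rewrite mulf_eq0 (negPf n3).
Qed.

(** Any solution of the two slope equations is the slope computed by [addp]; later proofs thus avoid
    its divisions and case split. *)
Lemma addp_third l x1 y1 x2 y2 :
  on_curve (Some (x1, y1)) -> on_curve (Some (x2, y2)) ->
  ~~ opposite x1 y1 x2 y2 -> slope l x1 y1 x2 y2 ->
  addp (Some (x1, y1)) (Some (x2, y2)) = oppp (Some (third l x1 y1 x2)).
Proof.
move=> C1 C2 nop [H1 H2]; rewrite /addp -/(opposite x1 y1 x2 y2) (negPf nop).
have -> : (if x1 == x2
               then (3%:R * x1 ^+ 2 + 2%:R * x1 - 2%:R - y1) / (2%:R * y1 + x1)
               else (y2 - y1) / (x2 - x1)) = l; last by [].
case: eqP => [E|/eqP E]; last first.
  by rewrite -H1 mulfK // subr_eq0 eq_sym.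
subst x2; case: (on_curve_same_x C1 C2) => E.
  subst y2; have -> : 3%:R * x1 ^+ 2 + 2%:R * x1 - 2%:R - y1 = l * (2%:R * y1 + x1).
    by apply: (eq_of_lin (k := - 1) H2); ring.
  rewrite mulfK //; apply: contraNneq nop => E.
  by rewrite /opposite eqxx /=; apply/eqP; apply: (eq_of_lin (k := 1) E); ring.
by move: nop; rewrite /opposite eqxx /= E eqxx.
Qed.

Lemma slope_exists x1 y1 x2 y2 :
  on_curve (Some (x1, y1)) -> on_curve (Some (x2, y2)) ->
  ~~ opposite x1 y1 x2 y2 -> exists l, slope l x1 y1 x2 y2.
Proof.
move=> C1 C2 nop; case: (eqVneq x1 x2) => [E|E].
  subst x2; case: (on_curve_same_x C1 C2) => E; last first.
    by move: nop; rewrite /opposite eqxx /= E eqxx.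
  subst y2; exists ((3%:R * x1 ^+ 2 + 2%:R * x1 - 2%:R - y1) / (2%:R * y1 + x1)).
  have d : 2%:R * y1 + x1 != 0.
    apply: contraNneq nop => E.
    by rewrite /opposite eqxx /=; apply/eqP; apply: (eq_of_lin (k := 1) E); ring.
  by split; [ring | field].
have d : x2 - x1 != 0 by rewrite subr_eq0 eq_sym.
exists ((y2 - y1) / (x2 - x1)); split; first by rewrite mulfVK.
(* Multiplied by [x2 - x1], the second slope equation is the difference of the two curve
   equations. *)
apply: (mulIf d); rewrite mulrAC mulfVK //.
by apply: (eq_of_lin2 (k := 1) (k' := - 1) C2 C1); ring.
Qed.

Variant addp_spec Q1 Q2 : Epoint F -> Prop :=
  | AddpNoneL of Q1 = None : addp_spec Q1 Q2 Q2
  | AddpNoneR of Q2 = None : addp_spec Q1 Q2 Q1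
  | AddpOpp of Q2 = oppp Q1 : addp_spec Q1 Q2 None
  | AddpThird l x1 y1 x2 y2 of Q1 = Some (x1, y1) & Q2 = Some (x2, y2) &
      ~~ opposite x1 y1 x2 y2 & slope l x1 y1 x2 y2 :
      addp_spec Q1 Q2 (oppp (Some (third l x1 y1 x2))).

Lemma addpP Q1 Q2 : on_curve Q1 -> on_curve Q2 -> addp_spec Q1 Q2 (addp Q1 Q2).
Proof.
case: Q1 => [[x1 y1]|]; last by move=> *; exact: AddpNoneL.
case: Q2 => [[x2 y2]|]; last by move=> *; exact: AddpNoneR.
move=> C1 C2; case: (boolP (opposite x1 y1 x2 y2)) => [op|nop].
  rewrite /addp -/(opposite x1 y1 x2 y2) op; apply: AddpOpp.
  by case/andP: op => /eqP -> /eqP ->.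
have [l Hl] := slope_exists C1 C2 nop.
by rewrite (addp_third C1 C2 nop Hl); apply: AddpThird Hl.
Qed.

Lemma addp_opp Q : on_curve Q -> addp Q (oppp Q) = None.
Proof. by case: Q => [[x y]|] //= _; rewrite !eqxx. Qed.

Lemma addpC Q1 Q2 : on_curve Q1 -> on_curve Q2 -> addp Q1 Q2 = addp Q2 Q1.
Proof.
move=> C1 C2; case: (addpP C1 C2) => [->|->|->|l x1 y1 x2 y2 E1 E2 nop Hl].
- by case: (Q2) => [[]|].
- by [].
- by rewrite -{2}[Q1]oppp_inv addp_opp //; apply: oppp_on_curve.
subst Q1 Q2; rewrite opposite_sym in nop.
by rewrite (addp_third C2 C1 nop (slope_sym Hl)) (third_sym Hl).
Qed.

Lemma addp_on_curve Q1 Q2 : on_curve Q1 -> on_curve Q2 -> on_curve (addp Q1 Q2).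
Proof.
move=> C1 C2; case: (addpP C1 C2) => // l x1 y1 x2 y2 E1 E2 nop Hl.
apply: oppp_on_curve; have := slope_third Hl.
case: third => x3 y3 /= /slope_on_curve; apply.
by rewrite -E1.
Qed.

Lemma oppp_addp Q1 Q2 : on_curve Q1 -> on_curve Q2 ->
  addp (oppp Q1) (oppp Q2) = oppp (addp Q1 Q2).
Proof.
move=> C1 C2; have := oppp_on_curve C2; have := oppp_on_curve C1.
case: (addpP C1 C2) => [->|->|->|l x1 y1 x2 y2 E1 E2 nop Hl] C1' C2' //.
- by case: (oppp Q1) => [[]|].
- by rewrite addp_opp.
subst Q1 Q2; rewrite (addp_third (l := - l - 1) C1' C2').
- by congr oppp; rewrite /third /=; congr (Some (_, _)); ring.
- apply: contra nop; rewrite /opposite => /andP[/eqP -> /eqP E].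
  by rewrite eqxx /=; apply/eqP; apply: (eq_of_lin (k := - 1) E); ring.
- exact: slope_opp.
Qed.

(** Reflecting the line through [Q1] and [Q2] gives a line of slope [- l - 1] through the sum and
    [oppp Q2], whose third point is [oppp Q1]. *)
Lemma addpK Q1 Q2 : on_curve Q1 -> on_curve Q2 ->
  addp (addp Q1 Q2) (oppp Q2) = Q1.
Proof.
move=> C1 C2; have C3 := addp_on_curve C1 C2; move: C3.
case: (addpP C1 C2) => [->|->|->|l x1 y1 x2 y2 E1 E2 nop Hl] C3.
- exact: addp_opp.
- by case: (Q1) => [[]|].
- by rewrite oppp_inv.
subst Q1 Q2; rewrite (third_sym Hl) in C3 *.
have Hs := slope_third (slope_sym Hl).
case E : (third l x2 y2 x1) Hs C3 => [x3 y3] /= Hs C3.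
apply: etrans (addp_third (l := - l - 1) C3 (oppp_on_curve C2) _ _) _.
(* If the sum and [oppp Q2] were opposite, the third point would be [Q2] with [2 y2 + x2 = 0], and
   the slope equation would make [Q2] singular. *)
- apply/negP => /andP[/eqP E3 /eqP E4]; subst x3.
  case: Hs => Hs1 Hs2; have E5 : y3 = y2 by apply: (eq_of_lin (k := - 1) Hs1); ring.
  subst y3; have E6 : 2%:R * y2 + x2 = 0 by apply: (eq_of_lin (k := - 1) E4); ring.
  case/eqP: (nonsingular C2 E6).
  by apply: (eq_of_lin2 (k := - 1) (k' := l) Hs2 E6); ring.
- exact/slope_opp/slope_sym.
move: E; rewrite /third => -[<- <-] /=; congr (Some (_, _)); first by ring.
by case: Hl => Hl _; apply: (eq_of_lin (k := - 1) Hl); ring.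
Qed.

Section Assoc.
Variables x0 y0 x1 y1 x2 y2 l1 l2 l3 l4 : F.
Let S := third l1 x1 y1 x0.
Let W := third l3 x0 y0 x2.
Hypothesis C0 : on_curve (Some (x0, y0)).
Hypothesis H1 : slope l1 x1 y1 x0 y0.
Hypothesis H3 : slope l3 x0 y0 x2 y2.
Hypothesis x12 : x1 != x2.
Hypothesis nop2 : ~~ opposite S.1 (- S.2 - S.1) x2 y2.
Hypothesis nop4 : ~~ opposite x1 y1 W.1 (- W.2 - W.1).
Hypothesis H2 : slope l2 S.1 (- S.2 - S.1) x2 y2.
Hypothesis H4 : slope l4 x1 y1 W.1 (- W.2 - W.1).

(** With the middle point translated to the origin, this is one of the three chord identities; [S]
    and [W] are the third points of the two inner lines. *)
Lemma third_assoc :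
  third l2 S.1 (- S.2 - S.1) x2 = third l4 x1 y1 W.1.
Proof.
have CP := slope_on_curve (slope_sym H1) C0.
have CR := slope_on_curve H3 C0.
have CS : on_curve (Some (S.1, - S.2 - S.1)).
  exact: oppp_on_curve (slope_on_curve (slope_third H1) CP).
have CW : on_curve (Some (W.1, - W.2 - W.1)).
  exact: oppp_on_curve (slope_on_curve (slope_third H3) C0).
rewrite (third_sym H2).
have [[h1 k1] [h3 k3]] := (slope_sym H1, H3).
have [h2 k2] := slope_sym H2; have [h4 k4] := H4.
pose u := x1 - x0; pose v := x2 - x0; pose a := 1 + 3%:R * x0.
pose b := 3%:R * x0 ^+ 2 + 2%:R * x0 - 2%:R - y0; pose c := 2%:R * y0 + x0.
have uv : u != v by rewrite /u /v (inj_eq (addIr _)).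
have I1 : l1 * (c + (l1 + 1) * u) = u ^+ 2 + a * u + b.
  by apply: (eq_of_lin2 (k := l1 + 1) (k' := 1) h1 k1); rewrite /u /c /a /b; ring.
have I3 : l3 * (c + (l3 + 1) * v) = v ^+ 2 + a * v + b.
  by apply: (eq_of_lin2 (k := l3 + 1) (k' := 1) h3 k3); rewrite /v /c /a /b; ring.
pose s := l1 ^+ 2 + l1 - a - u; pose w := l3 ^+ 2 + l3 - a - v.
have sE : s = S.1 - x0 by rewrite /s /a /u /S /=; ring.
have wE : w = W.1 - x0 by rewrite /w /a /v /W /=; ring.
have J1 : y1 = y0 + l1 * u by apply: (eq_of_lin (k := - 1) h1); rewrite /u; ring.
have J3 : y2 = y0 + l3 * v by apply: (eq_of_lin (k := - 1) h3); rewrite /v; ring.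
have S2E : S.2 = y0 + l1 * s by rewrite sE /S /third /= J1 /u; ring.
have W2E : W.2 = y0 + l3 * w by rewrite wE /W /third.
have S1E : S.1 = s + x0 by rewrite sE; ring.
have W1E : W.1 = w + x0 by rewrite wE; ring.
have e2 : l2 * (v - s) = l3 * v + c + (l1 + 1) * s.
  by apply: (eq_of_lin (k := - 1) h2); rewrite S2E S1E J3 /c /v; ring.
have e4 : l4 * (u - w) = l1 * u + c + (l3 + 1) * w.
  by apply: (eq_of_lin (k := - 1) h4); rewrite W2E W1E J1 /c /u; ring.
move: (nop2) (nop4) => nS nW.
(* Points with equal abscissae that are not opposite coincide, so the outer line is a tangent and
   its slope is read from the second slope equation. *)
have degS : s = v -> [/\ l3 * v + c + (l1 + 1) * s = 0,
    c + (2%:R * l3 + 1) * v != 0 &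
    l2 * (c + (2%:R * l3 + 1) * v) = 3%:R * v ^+ 2 + 2%:R * a * v + b - l3 * v].
  move=> sv; have Sx : S.1 = x2 by rewrite S1E sv /v; ring.
  rewrite Sx in CS nS k2; case: (on_curve_same_x CR CS) => Ey; last first.
    by case/negP: nS; rewrite /opposite eqxx Ey /=; apply/eqP; ring.
  rewrite -Ey in nS k2; split.
  - by apply: (eq_of_lin (k := 1) Ey); rewrite -Sx S2E S1E J3 /c; ring.
  - apply: contraNneq nS => d0; rewrite /opposite eqxx /=; apply/eqP.
    by apply: (eq_of_lin (k := 1) d0); rewrite J3 /c /v; ring.
  - by apply: (eq_of_lin (k := 1) k2); rewrite J3 /a /b /c /v; ring.
have degW : w = u -> [/\ l1 * u + c + (l3 + 1) * w = 0,
    c + (2%:R * l1 + 1) * u != 0 &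
    l4 * (c + (2%:R * l1 + 1) * u) = 3%:R * u ^+ 2 + 2%:R * a * u + b - l1 * u].
  move=> wu; have Wx : W.1 = x1 by rewrite W1E wu /u; ring.
  rewrite Wx in CW nW k4; case: (on_curve_same_x CP CW) => Ey; last first.
    by case/negP: nW; rewrite /opposite eqxx Ey /=; apply/eqP; ring.
  rewrite -Ey in nW k4; split.
  - by apply: (eq_of_lin (k := 1) Ey); rewrite -Wx W2E W1E J1 /c; ring.
  - apply: contraNneq nW => d0; rewrite /opposite eqxx /=; apply/eqP.
    by apply: (eq_of_lin (k := 1) d0); rewrite J1 /c /u; ring.
  - by apply: (eq_of_lin (k := 1) k4); rewrite J1 /a /b /c /u; ring.
have [Ex Ey] : let t := l2 ^+ 2 + l2 - a - s - v in
  t = l4 ^+ 2 + l4 - a - w - u /\ l3 * v + l2 * (t - v) = l1 * u + l4 * (t - u).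
  case: (eqVneq s v) => [sv|sv]; case: (eqVneq w u) => [wu|wu].
  - have [hs ds ts] := degS sv; have [hw dw tw] := degW wu.
    exact: (assoc_tangent_tangent uv I1 I3).
  - have [hs ds ts] := degS sv.
    exact: (assoc_tangent_chord uv I1 I3).
  (* The mirror case: exchanging the outer points reduces it to the same identity. *)
  - have [hw dw tw] := degW wu; rewrite eq_sym in uv.
    have [E1 E2] := assoc_tangent_chord uv I3 I1 wu hw sv dw tw e2.
    by rewrite -/s -/w in E1 E2; rewrite /= -E1 E2.
  - apply: (assoc_chord_chord (c := c)) => //.
    by rewrite I1 I3; move: (a) (b) (u) (v) => a' b' u' v'; ring.
have tE : l2 ^+ 2 + l2 - a - s - v = l2 ^+ 2 + l2 - 1 - x2 - S.1 - x0.
  by rewrite S1E /a /v; ring.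
have tE' : l4 ^+ 2 + l4 - a - w - u = l4 ^+ 2 + l4 - 1 - x1 - W.1 - x0.
  by rewrite W1E /a /u; ring.
rewrite tE tE' in Ex; rewrite tE in Ey.
rewrite /third; move: (addIr (- x0) Ex) Ey => <-.
move: (_ - _ - S.1) => X Ey; congr pair.
by apply: (eq_of_lin (k := 1) Ey); rewrite J1 J3 /u /v; ring.
Qed.
End Assoc.

(** Commutativity, cancellation and [oppp_addp] settle the positions where an inner or outer sum is
    0 or the outer points share an abscissa; the rest is [third_assoc]. *)
Lemma addpA Q1 Q2 Q3 : on_curve Q1 -> on_curve Q2 -> on_curve Q3 ->
  addp Q1 (addp Q2 Q3) = addp (addp Q1 Q2) Q3.
Proof.
case: Q1 => [[x1 y1]|] //; case: Q2 => [[x0 y0]|] //.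
case: Q3 => [[x2 y2]|]; last first.
  by case: (addp (Some _) (Some _)) => [[]|].
move=> C1 C0 C2; have [x12|x12] := eqVneq x1 x2.
  (* The third point is the first or its opposite. *)
  subst x2; have [->|->] := on_curve_same_x C1 C2.
    rewrite [RHS]addpC //; last exact: addp_on_curve.
    by rewrite [addp (Some (x0, _)) _]addpC.
  rewrite -[Some (x1, - y1 - x1)]/(oppp (Some (x1, y1))).
  have O1 := oppp_on_curve C1.
  rewrite [LHS]addpC //; last exact: addp_on_curve.
  rewrite [addp (Some (x1, _)) _]addpC // addpK //.
  by rewrite -{2}[Some (x1, y1)]oppp_inv addpK.
move: C1 C0 C2; set P1 := Some (x1, y1); set P0 := Some (x0, y0).
set P2 := Some (x2, y2) => C1 C0 C2.
have [op10|nop10] := boolP (opposite x1 y1 x0 y0).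
  have -> : P0 = oppp P1 by case/andP: op10 => /eqP E /eqP E'; rewrite /P0 E' -E.
  rewrite addp_opp // [RHS]/=; have O1 := oppp_on_curve C1.
  have := addpK C2 O1; rewrite oppp_inv addpC //; last exact: addp_on_curve.
  by rewrite [addp P2 _]addpC.
have [op02|nop02] := boolP (opposite x0 y0 x2 y2).
  have -> : P2 = oppp P0 by case/andP: op02 => /eqP E /eqP E'; rewrite /P2 E' -E.
  by rewrite addp_opp // addpK.
have [l1 H1] := slope_exists C1 C0 nop10.
have [l3 H3] := slope_exists C0 C2 nop02.
have CS := addp_on_curve C1 C0; have CW := addp_on_curve C0 C2.
have KS := addpK C1 C0; have KW : addp (addp P0 P2) (oppp P0) = P2.
  by rewrite [addp P0 P2]addpC // addpK.
move: CS CW KS KW.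
have := addp_third C0 C2 nop02 H3; have := addp_third C1 C0 nop10 H1.
case ES : (third l1 x1 y1 x0) => [xs ys]; case EW : (third l3 x0 y0 x2) => [xw yw].
rewrite -/P0 -/P1 -/P2 => ESp EWp; rewrite ESp EWp => CS CW KS KW.
(* Here [P2] is the opposite of [addp P1 P0]. Cancellation turns [addp P0 P2] into [oppp P1], so
   both sides vanish. The next case is symmetric. *)
have [opS|nopS] := boolP (opposite xs (- ys - xs) x2 y2).
  have E2 : P2 = oppp (oppp (Some (xs, ys))).
    by case/andP: opS => /eqP E /eqP E'; rewrite /P2 E' -E.
  have : addp P1 (addp P0 P2) = None.
    rewrite E2 addpC //; last exact/addp_on_curve/oppp_on_curve.
    rewrite [addp P0 _]addpC //; last exact: oppp_on_curve.
    rewrite -{1}[P0]oppp_inv oppp_addp //; last exact: oppp_on_curve.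
    by rewrite KS addpC ?addp_opp //; apply: oppp_on_curve.
  by rewrite EWp => ->; rewrite E2 addp_opp.
have [opW|nopW] := boolP (opposite x1 y1 xw (- yw - xw)).
  have E1 : oppp (Some (xw, yw)) = oppp P1.
    by case/andP: opW => /eqP E /eqP E'; rewrite /= E' E.
  rewrite E1 addp_opp // -ESp -[P1]oppp_inv -E1 -[P0]oppp_inv.
  rewrite oppp_addp //; last exact: oppp_on_curve.
  by rewrite KW addpC ?addp_opp //; apply: oppp_on_curve.
have [l2 H2] := slope_exists CS C2 nopS.
have [l4 H4] := slope_exists C1 CW nopW.
apply: etrans (addp_third C1 CW nopW H4) _.
apply/esym; apply: etrans (addp_third CS C2 nopS H2) _.
congr (oppp (Some _)).
have := @third_assoc x0 y0 x1 y1 x2 y2 l1 l2 l3 l4 C0 H1 H3 x12.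
by rewrite ES EW; apply.
Qed.
End Slopes.

(** * The abelian group of points and its 2-torsion *)

Definition on_curveb (F : fieldType) (Q : Epoint F) : bool :=
  if Q is Some (x, y) then y ^+ 2 + x * y == x ^+ 3 + x ^+ 2 - 2%:R * x else true.

Lemma on_curvebP (F : fieldType) (Q : Epoint F) :
  reflect (on_curve Q) (on_curveb Q).
Proof. by case: Q => [[x y]|] /=; [exact: eqP | exact: ReflectT]. Qed.

(* [charF] is a parameter of the type because the group law needs it. *)
Record point (F : fieldType) (charF : nonsingular_char F) : Type :=
  Point { point_val : option (F * F); point_valP : on_curveb point_val }.

Section PointGroup.
Variables (F : fieldType) (charF : nonsingular_char F).
Implicit Types Q : Epoint F.
Local Notation point := (point charF).

HB.instance Definition _ := [isSub for @point_val F charF].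
HB.instance Definition _ := [Choice of point by <:].

Lemma point_on_curve (Q : point) : on_curve (point_val Q).
Proof. exact/on_curvebP/point_valP. Qed.
Hint Resolve point_on_curve : core.

Definition mkpoint Q (C : on_curve Q) : point := Point charF (introT (on_curvebP Q) C).

Definition point_zero : point := @Point F charF None isT.
Definition point_add (Q1 Q2 : point) : point :=
  mkpoint (addp_on_curve (point_on_curve Q1) (point_on_curve Q2)).
Definition point_opp (Q : point) : point :=
  mkpoint (oppp_on_curve (point_on_curve Q)).

Lemma point_addA : associative point_add.
Proof. by move=> Q1 Q2 Q3; apply: val_inj; apply: addpA. Qed.
Lemma point_addC : commutative point_add.
Proof. by move=> Q1 Q2; apply: val_inj; apply: addpC. Qed.
Lemma point_add0 : left_id point_zero point_add.
Proof. by move=> Q; apply: val_inj. Qed.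
Lemma point_addN : left_inverse point_zero point_opp point_add.
Proof.
move=> Q; apply: val_inj; rewrite /= addpC ?addp_opp //.
exact/oppp_on_curve/point_on_curve.
Qed.

HB.instance Definition _ :=
  GRing.isZmodule.Build point point_addA point_addC point_add0 point_addN.

Lemma point_valD (Q1 Q2 : point) :
  point_val (Q1 + Q2) = addp (point_val Q1) (point_val Q2).
Proof. by []. Qed.

Lemma point_valMn (Q : point) n : point_val (Q *+ n) = mulp n (point_val Q).
Proof. by elim: n => // n IH; rewrite mulrS point_valD IH. Qed.

Lemma point_val_lincomb (Q1 Q2 : point) m n :
  point_val (Q1 *+ m + Q2 *+ n) = lincomb m n (point_val Q1) (point_val Q2).
Proof. by rewrite point_valD !point_valMn. Qed.

Lemma ptP_on_curve : on_curve (ptP F).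
Proof. by rewrite /=; ring. Qed.

Definition point_P : point := mkpoint ptP_on_curve.

(** The exact order divides every exponent that kills [Q], and a divisor of an odd number is odd. *)
Lemma mulp_odd_orderP (Q : point) :
  has_odd_order (point_val Q) <-> exists2 n, odd n & Q *+ n = 0.
Proof.
split=> [[n [_ Qn _] n_odd]|[n n_odd Qn]].
  by exists n => //; apply: val_inj; rewrite /= point_valMn.
have exn : exists m, (0 < m)%N && (Q *+ m == 0).
  by exists n; rewrite Qn eqxx andbT; case: (n) n_odd.
case: (ex_minnP exn) => m /andP[m0 /eqP Qm] m_min.
exists m.
  split=> // [|k /andP[k0 km]]; first by rewrite -point_valMn Qm.
  rewrite -point_valMn => Qk; have /eqP Qk0 : Q *+ k = 0 by exact: val_inj.
  by have := m_min k; rewrite k0 Qk0 leqNgt km => /(_ isT).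
have : (m %| n)%N.
  rewrite /dvdn -leqn0 leqNgt; apply/negP => r0.
  have := m_min (n %% m)%N; rewrite r0 /= leqNgt ltn_mod m0 => H.
  suff: Q *+ (n %% m) == 0 by move/H.
  move: Qn; rewrite {1}(divn_eq n m) mulrnDr mulnC mulrnA Qm mul0rn add0r.
  by move/eqP.
by case/dvdnP => k E; move: n_odd; rewrite E oddM => /andP[].
Qed.

(** From [- Q = Q] one gets [2 y = - x]; substituted in the curve equation, this leaves the
    2-division polynomial. *)
Lemma two_torsion_abscissa (Q : point) : Q *+ 2 = 0 -> Q != 0 ->
  exists2 x, point_val Q = Some (x, - x / 2%:R)
    & x * (4%:R * x ^+ 2 + 5%:R * x - 8%:R) = 0.
Proof.
have n2 := nonsingular_nat_neq0 charF (isT : 2 %| 102)%N.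
move=> Q2; have : - Q = Q by apply/eqP; rewrite eq_sym -addr_eq0 -mulr2n Q2.
case: Q {Q2} => [[[x y]|] C] E Q0; last by case/eqP: Q0; apply: val_inj.
move/(congr1 (@point_val F charF)): E => /= -[] E.
have Ey : y = - x / 2%:R.
  by apply: (mulIf n2); rewrite mulfVK //; apply: (eq_of_lin (k := - 1) E); ring.
exists x; first by rewrite /= {1}Ey.
move/on_curvebP: (C) => /= H; rewrite {}Ey in H.
apply: (eq_of_lin (k := - 4%:R) H); field; exact: n2.
Qed.

(** Otherwise there would be four nonzero 2-torsion points. Each is determined by its abscissa, a
    root of the cubic 2-division polynomial [q]. *)
Lemma two_torsion_cover (Q1 Q2 Q3 Q : point) :
  Q1 *+ 2 = 0 -> Q2 *+ 2 = 0 -> Q3 *+ 2 = 0 -> Q *+ 2 = 0 ->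
  uniq [:: 0; Q1; Q2; Q3] -> Q \in [:: 0; Q1; Q2; Q3].
Proof.
move=> T1 T2 T3 T Hu; apply/negPn/negP => Qn.
have Hu' : uniq [:: Q; Q1; Q2; Q3].
  by move: Hu Qn; rewrite /= !inE !negb_or => /andP[_ ->] /andP[_ ->].
have nz Z : Z \in [:: Q; Q1; Q2; Q3] -> Z != 0.
  rewrite !inE => /or4P[] /eqP ->.
  - by apply: contraNneq Qn => ->; rewrite inE eqxx.
  - by apply: contraTneq Hu => ->; rewrite cons_uniq inE eqxx.
  - by apply: contraTneq Hu => ->; rewrite cons_uniq !inE eqxx orbT.
  - by apply: contraTneq Hu => ->; rewrite cons_uniq !inE eqxx !orbT.
have tor Z : Z \in [:: Q; Q1; Q2; Q3] -> Z *+ 2 = 0.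
  by rewrite !inE => /or4P[] /eqP ->.
pose absc (Z : point) := if point_val Z is Some (x, _) then x else 0.
pose q : {poly F} := Poly [:: 0; - 8%:R; 5%:R; 4%:R].
have n2 := nonsingular_nat_neq0 charF (isT : 2 %| 102)%N.
have q0 : q != 0.
  apply/eqP => /(congr1 (fun q : {poly F} => q`_1)); rewrite coef_Poly coef0 /=.
  by move/eqP; rewrite oppr_eq0 (natrM _ 2 4) (natrM _ 2 2) !mulf_eq0 (negPf n2).
have sq : (size q <= 4)%N by exact: size_Poly.
have : (size (map absc [:: Q; Q1; Q2; Q3]) < size q)%N.
  apply: max_poly_roots => //.
    apply/allP => z /mapP[Z /[dup] /nz Z0 /tor TZ ->].
    have [x E Ex] := two_torsion_abscissa TZ Z0.
    rewrite /absc E /root /q horner_Poly /=; apply/eqP.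
    by apply: (eq_of_lin (k := 1) Ex); ring.
  rewrite map_inj_in_uniq // => Z Z' /[dup] /nz Z0 /tor TZ /[dup] /nz Z'0 /tor TZ'.
  have [x E _] := two_torsion_abscissa TZ Z0.
  have [x' E' _] := two_torsion_abscissa TZ' Z'0.
  by rewrite /absc E E' => Ex; apply: val_inj; rewrite /= E E' Ex.
by rewrite /= ltnNge sq.
Qed.

End PointGroup.

(** * Points under field morphisms *)

Section MapPoint.
Variables (F G : fieldType) (f : {rmorphism F -> G}).

Lemma map_point_on_curve (Q : Epoint F) : on_curve (map_point f Q) <-> on_curve Q.
Proof.
case: Q => [[x y]|] //=; split=> H; last first.
  rewrite -!rmorphXn -!rmorphM -!rmorphD H.
  by rewrite !(rmorph_nat, rmorphD, rmorphN, rmorphM, rmorphXn).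
apply: (fmorph_inj f).
by rewrite !(rmorph_nat, rmorphD, rmorphN, rmorphM, rmorphXn).
Qed.

Lemma map_point_inj : injective (map_point f).
Proof.
by move=> [[x y]|] [[x' y']|] //= [] /(fmorph_inj f) -> /(fmorph_inj f) ->.
Qed.

Lemma map_point_addp (Q1 Q2 : Epoint F) :
  map_point f (addp Q1 Q2) = addp (map_point f Q1) (map_point f Q2).
Proof.
case: Q1 Q2 => [[x1 y1]|] [[x2 y2]|] //=.
have -> : - f y1 - f x1 = f (- y1 - x1) by rewrite !(rmorphD, rmorphN).
rewrite !(inj_eq (fmorph_inj f)); case: ifP => //= _.
congr (Some (_, _)); case: ifP => _;
  by rewrite !(rmorph_nat, rmorph1, rmorphD, rmorphN, rmorphM, rmorphXn, fmorphV).
Qed.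

Lemma map_point_mulp n (Q : Epoint F) : map_point f (mulp n Q) = mulp n (map_point f Q).
Proof. by elim: n => //= n IH; rewrite map_point_addp IH. Qed.

Lemma map_point_lincomb m n (Q1 Q2 : Epoint F) :
  map_point f (lincomb m n Q1 Q2) = lincomb m n (map_point f Q1) (map_point f Q2).
Proof. by rewrite /lincomb map_point_addp !map_point_mulp. Qed.

Lemma map_point_P : map_point f (ptP F) = ptP G.
Proof. by rewrite /= !rmorph_nat. Qed.
End MapPoint.

(** * Reduction of points *)

Section Specialization.
Variables (D : comNzRingType) (K k : fieldType).
Variables (i : {rmorphism D -> K}) (f : {rmorphism D -> k}).
Implicit Types (z x y l : K) (w : k) (Q : Epoint K) (q : Epoint k).
Hypothesis i_inj : injective i.
(* Degree four suffices, since x satisfies a quartic equation over x(2Q). *)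
Hypothesis D_closed : forall z (c3 c2 c1 c0 : D),
  z ^+ 4 + i c3 * z ^+ 3 + i c2 * z ^+ 2 + i c1 * z + i c0 = 0 ->
  exists d, z = i d.

(* The residue map of the localization of [i D] at the kernel of [f]. *)
Definition spec z w : Prop :=
  exists a b, [/\ f b != 0, z * i b = i a & w * f b = f a].

Definition integral z : Prop := exists w, spec z w.

Lemma spec_image d : spec (i d) (f d).
Proof. by exists d, 1; rewrite !rmorph1 !mulr1 oner_eq0. Qed.

Lemma spec_nat n : spec n%:R n%:R.
Proof. by have := spec_image n%:R; rewrite !rmorph_nat. Qed.

Lemma spec1 : spec 1 1. Proof. exact: (spec_nat 1). Qed.

Lemma specD z w z' w' : spec z w -> spec z' w' -> spec (z + z') (w + w').
Proof.
case=> a [b [b0 E F]] [a' [b' [b0' E' F']]]; exists (a * b' + a' * b), (b * b').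
rewrite !rmorphD !rmorphM mulf_neq0 // -E -E' -F -F'; split=> //; ring.
Qed.

Lemma specN z w : spec z w -> spec (- z) (- w).
Proof.
by case=> a [b [b0 E F]]; exists (- a), b; rewrite !rmorphN -E -F !mulNr.
Qed.

Lemma specB z w z' w' : spec z w -> spec z' w' -> spec (z - z') (w - w').
Proof. by move=> H H'; apply/specD/specN. Qed.

Lemma specM z w z' w' : spec z w -> spec z' w' -> spec (z * z') (w * w').
Proof.
case=> a [b [b0 E F]] [a' [b' [b0' E' F']]]; exists (a * a'), (b * b').
rewrite !rmorphM mulf_neq0 // -E -E' -F -F'; split=> //; ring.
Qed.

Lemma specX z w n : spec z w -> spec (z ^+ n) (w ^+ n).
Proof.
by move=> H; elim: n => [|n IH]; [exact: spec1 | rewrite !exprS; exact: specM].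
Qed.

Lemma spec_unique z w w' : spec z w -> spec z w' -> w = w'.
Proof.
case=> a [b [b0 E F]] [a' [b' [b0' E' F']]].
have /(congr1 f) : a * b' = a' * b.
  by apply: i_inj; rewrite !rmorphM -E -E'; ring.
rewrite !rmorphM -F -F' => H; apply: (mulIf (mulf_neq0 b0 b0')).
by rewrite mulrA H; ring.
Qed.

Lemma specV z w : spec z w -> w != 0 -> spec z^-1 w^-1.
Proof.
move=> H w0; have z0 : z != 0.
  by apply: contraNneq w0 => z0; rewrite z0 in H; rewrite (spec_unique H (spec_nat 0)).
case: H => a [b [b0 E F]]; exists b, a; split.
- by rewrite -F mulf_neq0.
- by rewrite -E mulKf.
- by rewrite -F mulKf.
Qed.

(** Scaling [z] by a common denominator [s] multiplies the coefficient of [z ^+ j] by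
    [s ^+ (4 - j)], so that [D_closed] applies; [f s != 0] allows division by [s] afterwards. *)
Lemma integral_quartic z c3 c2 c1 c0 :
  integral c3 -> integral c2 -> integral c1 -> integral c0 ->
  z ^+ 4 + c3 * z ^+ 3 + c2 * z ^+ 2 + c1 * z + c0 = 0 -> integral z.
Proof.
case=> w3 [a3 [b3 [n3 E3 _]]] [w2 [a2 [b2 [n2 E2 _]]]].
case=> w1 [a1 [b1 [n1 E1 _]]] [w0 [a0 [b0 [n0 E0 _]]]] H.
pose s := b3 * b2 * b1 * b0.
have s0 : f s != 0 by rewrite !rmorphM !mulf_neq0.
case: (@D_closed (z * i s) (a3 * (b2 * b1 * b0)) (s * (a2 * (b3 * b1 * b0)))
         (s ^+ 2 * (a1 * (b3 * b2 * b0))) (s ^+ 3 * (a0 * (b3 * b2 * b1)))).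
  apply: (eq_of_lin (k := i s ^+ 4) H); rewrite /s !(rmorphM, rmorphXn) -E3 -E2 -E1 -E0.
  by ring.
by move=> d Ed; exists (f d / f s), d, s; rewrite mulfVK.
Qed.

Lemma integral_quadratic z c1 c0 : integral c1 -> integral c0 ->
  z ^+ 2 + c1 * z + c0 = 0 -> integral z.
Proof.
move=> H1 H0 H; have I0 : integral 0 by exists 0; exact: (spec_nat 0).
by apply: (integral_quartic H1 H0 I0 I0); apply: (eq_of_lin (k := z ^+ 2) H); ring.
Qed.

(** The abscissa decides, since the ordinate is a root of a monic quadratic over it. The point at
    infinity counts as integral. *)
Definition integral_point Q : Prop := if Q is Some (x, _) then integral x else True.

Definition spec_point Q q : Prop :=
  match Q, q with
  | None, None => True
  | Some (x, y), Some (x', y') => spec x x' /\ spec y y'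
  | Some (x, _), None => ~ integral x
  | None, Some _ => False
  end.

Lemma integral_ordinate x y : on_curve (Some (x, y)) -> integral x -> integral y.
Proof.
move=> /= C [x' Hx]; apply: (@integral_quadratic y x (- (x ^+ 3 + x ^+ 2 - 2%:R * x))).
- by exists x'.
- exists (- (x' ^+ 3 + x' ^+ 2 - 2%:R * x')).
  by apply/specN/specB; [apply: specD; exact: specX | apply: specM => //; exact: spec_nat].
- by apply: (eq_of_lin (k := 1) C); ring.
Qed.

Lemma spec_point_exists Q : on_curve Q -> exists q, spec_point Q q.
Proof.
case: Q => [[x y]|]; last by exists None.
move=> C; have [Ix|nI] := pselect (integral x); last by exists None.
have [y' Hy] := integral_ordinate C Ix.
by have [x' Hx] := Ix; exists (Some (x', y')).
Qed.

Lemma spec_point_unique Q q q' : spec_point Q q -> spec_point Q q' -> q = q'.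
Proof.
case: Q q q' => [[x y]|] [[x1 y1]|] [[x2 y2]|] //=.
- by move=> [H1 H2] [H3 H4]; rewrite (spec_unique H1 H3) (spec_unique H2 H4).
- by case=> H _ []; exists x1.
- by move=> nI [H _]; case: nI; exists x2.
Qed.

Lemma spec_on_curve Q q : on_curve Q -> spec_point Q q -> on_curve q.
Proof.
case: Q q => [[x y]|] [[x' y']|] //= C [Hx Hy].
have H1 : spec (y ^+ 2 + x * y) (y' ^+ 2 + x' * y').
  by apply: specD; [exact: specX | exact: specM].
apply: (spec_unique H1); rewrite C; apply: specB.
  by apply: specD; exact: specX.
by apply: specM => //; exact: spec_nat.
Qed.

Lemma spec_point_opp Q q : spec_point Q q -> spec_point (oppp Q) (oppp q).
Proof.
case: Q q => [[x y]|] [[x' y']|] //= [Hx Hy]; split=> //.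
exact/specB/Hx/specN.
Qed.

(** In one of the two slope equations the coefficient of the slope stays nonzero in [k], and
    dividing by it commutes with reduction. *)
Lemma spec_slope l x1 y1 x2 y2 (l' x1' y1' x2' y2' : k) :
  spec x1 x1' -> spec y1 y1' -> spec x2 x2' -> spec y2 y2' ->
  on_curve (Some (x1', y1')) -> on_curve (Some (x2', y2')) ->
  ~~ opposite x1' y1' x2' y2' ->
  slope l x1 y1 x2 y2 -> slope l' x1' y1' x2' y2' -> spec l l'.
Proof.
move=> Hx1 Hy1 Hx2 Hy2 C1 C2 nop [E1 E2] [E1' E2'].
have spec_div u u' d d' : spec u u' -> spec d d' -> d' != 0 ->
    l * d = u -> l' * d' = u' -> spec l l'.
  move=> Hu Hd d0 E E'; have dn0 : d != 0.
    by apply: contraNneq d0 => d0; rewrite d0 in Hd; rewrite (spec_unique Hd (spec_nat 0)).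
  have -> : l = u / d by rewrite -E mulfK.
  have -> : l' = u' / d' by rewrite -E' mulfK.
  exact/specM/specV.
have [Ex|nx] := eqVneq x1' x2'; last first.
  apply: spec_div E1 E1'; [exact: specB | exact: specB | by rewrite subr_eq0 eq_sym].
apply: spec_div E2 E2'.
- apply: specB => //; apply: specB; last exact: spec_nat.
  by do 4?apply: specD; rewrite ?expr2 //; apply: specM.
- by do 2?apply: specD.
- apply: contraNneq nop => d0; rewrite /opposite Ex eqxx /=; apply/eqP.
  by apply: (eq_of_lin (k := 1) d0); rewrite Ex; ring.
Qed.

Hypothesis chk : nonsingular_char k.

(** The delicate case is that of opposite reductions. If the sum were affine and integral, the
    slope, a root of a monic quadratic, would be integral too; reducing both slope equations would
    then exhibit a singular point over [k]. *)
Lemma spec_point_addp Q1 Q2 q1 q2 : on_curve Q1 -> on_curve Q2 ->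
  integral_point Q1 -> integral_point Q2 ->
  spec_point Q1 q1 -> spec_point Q2 q2 ->
  spec_point (addp Q1 Q2) (addp q1 q2).
Proof.
case: Q1 q1 => [[x1 y1]|] [[x1' y1']|] //.
case: Q2 q2 => [[x2 y2]|] [[x2' y2']|]  //.
move=> C1 C2 _ _ S1 S2.
have c1 := spec_on_curve C1 S1; have c2 := spec_on_curve C2 S2.
case: S1 S2 => Hx1 Hy1 [Hx2 Hy2].
have [op|nop] := boolP (opposite x1' y1' x2' y2').
  rewrite {2}/addp -/(opposite x1' y1' x2' y2') op.
  case: (addpP C1 C2) => // l ? ? ? ? [<- <-] [<- <-] _ [E1 E2] /= [x3' Hx3].
  have [l' Hl] : integral l.
    apply: (@integral_quadratic l 1 (- (third l x1 y1 x2).1 - 1 - x1 - x2)).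
    - by exists 1; exact: spec1.
    - exists (- x3' - 1 - x1' - x2').
      by do 3![apply: specB => //]; [exact: specN | exact: spec1].
    - by rewrite /=; ring.
  case/andP: op => /eqP Ex /eqP Ey; subst x2'.
  have H1 : l' * (y1' + y2' + x1') = 
      x1' ^+ 2 + x1' * x1' + x1' ^+ 2 + x1' + x1' - 2%:R - y2'.
    have HL : spec (l * (y1 + y2 + x1)) (l' * (y1' + y2' + x1')).
      by apply: specM => //; do 2?apply: specD.
    apply: (spec_unique HL); rewrite E2.
    apply: specB => //; apply: specB; last exact: spec_nat.
    by do 4?apply: specD; rewrite ?expr2 //; apply: specM.
  have H2 : l' * (x1' - x1') = y2' - y1'.
    have HL : spec (l * (x2 - x1)) (l' * (x1' - x1')) by apply/specM/specB.
    by apply: (spec_unique HL); rewrite E1; exact: specB.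
  have Hd : 2%:R * y1' + x1' = 0.
    by apply: (eq_of_lin2 (k := 1) (k' := 1) Ey H2); ring.
  case/eqP: (nonsingular chk c1 Hd).
  have E12 : y2' = y1' by apply: (eq_of_lin (k := - 1) H2); ring.
  by rewrite E12 in H1; apply: (eq_of_lin2 (k := - 1) (k' := l') H1 Hd); ring.
have [l' Hl'] := slope_exists c1 c2 nop.
rewrite (addp_third c1 c2 nop Hl').
case: (addpP C1 C2) => // [E|l x1_ y1_ x2_ y2_ [<- <-] [<- <-] _ Hl].
  case: E nop => Ex Ey; case/negP.
  rewrite {}Ex {}Ey in Hx2 Hy2; rewrite (spec_unique Hx1 Hx2) /opposite eqxx /=.
  by apply/eqP/(spec_unique Hy2)/specB => //; exact: specN.
have L := spec_slope Hx1 Hy1 Hx2 Hy2 c1 c2 nop Hl Hl'.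
have L3 : spec (third l x1 y1 x2).1 (third l' x1' y1' x2').1.
  by do 3![apply: specB => //]; [apply: specD => //; exact: specX | exact: spec1].
apply: (@spec_point_opp (Some (third l x1 y1 x2)) (Some (third l' x1' y1' x2'))).
by split=> //; apply: specD => //; apply: specM => //; exact: specB.
Qed.

Lemma integral_half Q : on_curve Q -> integral_point (addp Q Q) -> integral_point Q.
Proof.
case: Q => [[x y]|] // C.
have two0 : 2%:R != 0 :> k by exact: (nonsingular_nat_neq0 chk (isT : 2 %| 102)%N).
have four0 : 4%:R != 0 :> k by rewrite (natrM _ 2 2) mulf_neq0.
case: (addpP C C) => // [[Ey]|l x_ y_ x2_ y2_ [<- <-] [<- <-] _ [E1 E2]].
  move=> _; have I0 : integral 0 by exists 0; exact: (spec_nat 0).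
  (* When 2Q = 0, this is [x / 4] times the 2-division polynomial; 4 is invertible in [k]. *)
  apply: (@integral_quartic x (5%:R / 4%:R) (- 2%:R) 0 0) => //.
  - exists (5%:R / 4%:R); apply: specM; first exact: spec_nat.
    by apply: specV => //; exact: spec_nat.
  - by exists (- 2%:R); exact/specN/spec_nat.
  have n4 : 4%:R != 0 :> K.
    apply: contraNneq four0 => E; have := spec_nat 4; rewrite E => H.
    by rewrite (spec_unique H (spec_nat 0)).
  have Hd : 2%:R * y + x = 0 by apply: (eq_of_lin (k := 1) Ey); ring.
  apply: (mulIf n4); rewrite mul0r.
  apply: (@eq_of_lin2 _ (- 4%:R * x) (x * (2%:R * y + x)) _ _ _ _ _ _ C Hd).
  by field.
rewrite /= => -[x3' Hx3].
have Hx3' : spec (l ^+ 2 + l - 1 - x - x) x3' by [].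
(* The duplication formula [x(2Q) = (x^2 + 2)^2 / (4 x^3 + 5 x^2 - 8 x)], cleared of its
   denominator. *)
apply: (@integral_quartic x (- (4%:R * (l ^+ 2 + l - 1 - x - x)))
  (4%:R - 5%:R * (l ^+ 2 + l - 1 - x - x)) (8%:R * (l ^+ 2 + l - 1 - x - x)) 4%:R).
- by exists (- (4%:R * x3')); apply/specN/specM => //; exact: spec_nat.
- exists (4%:R - 5%:R * x3'); apply: specB; first exact: spec_nat.
  by apply: specM => //; exact: spec_nat.
- by exists (8%:R * x3'); apply: specM => //; exact: spec_nat.
- by exists 4%:R; exact: spec_nat.
apply: (@eq_of_lin2 _
  (- (l * (2%:R * y + x) + 3%:R * x ^+ 2 + 2%:R * x - 2%:R - y + (2%:R * y + x)))
  (4%:R * (l ^+ 2 + l - 1 - x - x) + 1 + 4%:R * (1 + 2%:R * x)) _ _ _ _ _ _ E2 C).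
by ring.
Qed.

(** For nonintegral [Q], the contrapositive of [integral_half] sends the double to infinity as
    well. *)
Lemma spec_point_double Q q : on_curve Q -> spec_point Q q ->
  spec_point (addp Q Q) (addp q q).
Proof.
move=> C H; have [I|nI] := pselect (integral_point Q).
  exact: spec_point_addp.
case: q H => [[x' y']|] H.
  by case: nI; case: (Q) H => [[x y]|] //= [Hx _]; exists x'.
have := contra_not (integral_half C) nI.
by case: (addp Q Q) => [[]|].
Qed.

Hypothesis chK : nonsingular_char K.
Implicit Types (P : point chK) (p : point chk).

(** Integrality removes the nonzero points of the kernel of reduction, whence [reduces_eq0]. *)
Definition reduces P p : Prop :=
  integral_point (point_val P) /\ spec_point (point_val P) (point_val p).

Lemma reduces0 : reduces 0 0. Proof. by []. Qed.

Lemma reduces_exists P : integral_point (point_val P) -> exists p, reduces P p.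
Proof.
move=> IP; have [q Hq] := spec_point_exists (point_on_curve P).
by exists (mkpoint chk (spec_on_curve (point_on_curve P) Hq)).
Qed.

Lemma reduces_unique P p p' : reduces P p -> reduces P p' -> p = p'.
Proof.
by move=> [_ H] [_ H']; apply: val_inj; exact: spec_point_unique H H'.
Qed.

Lemma reducesD P P' p p' : integral_point (point_val (P + P')) ->
  reduces P p -> reduces P' p' -> reduces (P + P') (p + p').
Proof.
move=> I [I1 H1] [I2 H2]; split=> //.
by apply: spec_point_addp => //; exact: point_on_curve.
Qed.

Lemma reduces_eq0 P : reduces P 0 -> P = 0.
Proof.
by case=> I H; apply: val_inj => /=; case: (point_val P) I H => [[x y]|] //= I /(_ I).
Qed.

Lemma integral_two_power_division P n :
  integral_point (point_val (P *+ 2 ^ n)) -> integral_point (point_val P).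
Proof.
elim: n P => [|n IH] P; first by rewrite expn0 mulr1n.
rewrite expnS mulrnA => /IH; rewrite mulr2n => /integral_half; apply.
exact: point_on_curve.
Qed.

End Specialization.

(** * Frobenius acting on the 2-power torsion *)

Section TorsionLattice.
Variables (G : zmodType) (r : nat).
Hypothesis r_gt0 : (0 < r)%N.
Let N := (2 ^ r)%N.
Variables (A B : G).
Hypotheses (NA : A *+ N = 0) (NB : B *+ N = 0).

Let N_gt1 : (1 < N)%N. Proof. by rewrite -[1%N](expn0 2) ltn_exp2l. Qed.

Definition lattice (x : 'rV['Z_N]_2) : G := A *+ x 0 0 + B *+ x 0 1.

Lemma mulrn_Zp (Q : G) (c d : 'Z_N) : Q *+ N = 0 ->
  Q *+ (c + d)%R = Q *+ c + Q *+ d.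
Proof.
move=> QN; have Qmod n : Q *+ (n %% N) = Q *+ n.
  by rewrite {2}(divn_eq n N) mulrnDr mulnC mulrnA QN mul0rn add0r.
have -> : nat_of_ord (c + d)%R = ((c + d) %% N)%N.
  by rewrite /=; congr (_ %% _)%N; exact: Zp_cast.
by rewrite Qmod mulrnDr.
Qed.

Lemma lattice_zmod_morphism : zmod_morphism lattice.
Proof.
move=> x y; have latticeD u w : lattice (u + w) = lattice u + lattice w.
  by rewrite /lattice !mxE !mulrn_Zp // addrACA.
by have := latticeD (x - y) y; rewrite subrK => ->; rewrite addrK.
Qed.

HB.instance Definition _ :=
  GRing.isZmodMorphism.Build 'rV['Z_N]_2 G lattice lattice_zmod_morphism.

Lemma latticeZ (c : 'Z_N) x : lattice (c *: x) = lattice x *+ c.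
Proof. by rewrite -{1}(natr_Zp c) scaler_nat raddfMn. Qed.

Lemma lattice_torsion x : lattice x *+ N = 0.
Proof. by rewrite -raddfMn -scaler_nat pchar_Zp // scale0r raddf0. Qed.

Hypothesis lattice_inj : injective lattice.
Hypothesis two_torsion_le4 : forall Q1 Q2 Q3 Q : G,
  Q1 *+ 2 = 0 -> Q2 *+ 2 = 0 -> Q3 *+ 2 = 0 -> Q *+ 2 = 0 ->
  uniq [:: 0; Q1; Q2; Q3] -> Q \in [:: 0; Q1; Q2; Q3].

Let half : 'Z_N := (2 ^ r.-1)%:R.

Let half_neq0 : half != 0.
Proof.
rewrite /half -val_eqE /= val_Zp_nat // modn_small ?expn_eq0 //.
by rewrite ltn_exp2l // prednK.
Qed.

Let half2 : half *+ 2 = 0.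
Proof. by rewrite /half -mulrnA mulnC -expnS prednK // pchar_Zp. Qed.

(** The multiples of [half] already give four distinct 2-torsion elements of the lattice, and [G]
    has at most four. *)
Lemma two_torsion_lattice Q : Q *+ 2 = 0 -> exists x, Q = lattice x.
Proof.
move=> Q2; pose e (j : 'I_2) : 'rV['Z_N]_2 := half *: delta_mx 0 j.
have tor x : lattice (half *: x) *+ 2 = 0.
  by rewrite -raddfMn scalerMnl half2 scale0r raddf0.
have Hu : uniq [:: 0; e 0; e 1; half *: const_mx 1].
  have neq j (u w : 'rV['Z_N]_2) : u 0 j != w 0 j -> u != w.
    by apply: contraNneq => ->.
  have nz : half * 1 != 0 by rewrite mulr1.
  rewrite /= !inE !negb_or !andbT; apply/and3P.
  split; [apply/and3P; split|apply/andP; split|].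
  - by apply: (neq 0); rewrite !mxE /= eq_sym.
  - by apply: (neq 1); rewrite !mxE /= eq_sym.
  - by apply: (neq 0); rewrite !mxE /= eq_sym.
  - by apply: (neq 0); rewrite !mxE /= mulr0.
  - by apply: (neq 1); rewrite !mxE /= mulr0 eq_sym.
  - by apply: (neq 0); rewrite !mxE /= mulr0 eq_sym.
have := Hu; rewrite -(map_inj_uniq lattice_inj) [map _ _]/= raddf0.
move/(two_torsion_le4 (tor _) (tor _) (tor _) Q2).
rewrite !inE => /or4P[] /eqP ->; by [exists 0; rewrite raddf0 | eexists].
Qed.

(** By induction 2Q is [lattice x], where [x] is killed by a power of 2 below [N] and so is even; Q
    differs from [lattice] of half of [x] by 2-torsion. *)
Lemma torsion_lattice s Q : (s <= r)%N -> Q *+ 2 ^ s = 0 -> exists x, Q = lattice x.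
Proof.
elim: s Q => [|s IH] Q sr.
  by rewrite expn0 mulr1n => ->; exists 0; rewrite raddf0.
rewrite expnS mulrnA => /[dup] Qs /IH [|x Qx]; first exact: ltnW.
have even_x j : ~~ odd (x 0 j).
  have : (2 ^ s)%:R *: x = 0.
    by apply: lattice_inj; rewrite scaler_nat raddfMn /= -Qx Qs raddf0.
  move/rowP/(_ j); rewrite !mxE -[x 0 j]natr_Zp -natrM => /(congr1 val) /=.
  rewrite val_Zp_nat // natr_Zp; move: (nat_of_ord (x 0 j)) => m /eqP.
  rewrite -/(dvdn _ _) /N -(subnKC sr) expnD expnSr -mulnA dvdn_pmul2l ?expn_gt0 //.
  by move/(dvdn_trans (dvdn_mulr _ (dvdnn 2))); rewrite dvdn2.
pose x' : 'rV['Z_N]_2 := \row_j (x 0 j)./2%:R.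
have Ex : x = x' *+ 2.
  by apply/rowP => j; rewrite mulmxnE mxE -mulrnA muln2 even_halfK // natr_Zp.
have : (Q - lattice x') *+ 2 = 0 by rewrite mulrnBl Qx {1}Ex raddfMn /= subrr.
by case/two_torsion_lattice => y Ey; exists (y + x'); rewrite raddfD /= -Ey subrK.
Qed.

Variable phi : {additive G -> G}.
Variables (M : 'M['Z_N]_2) (v : 'rV['Z_N]_2) (beta : G).
Hypothesis phiA : phi A = lattice (row 0 M).
Hypothesis phiB : phi B = lattice (row 1 M).
Hypothesis phi_beta : phi beta = beta + lattice v.
Hypothesis det_neq0 : \det (1%:M - M) != 0.

Lemma phi_lattice x : phi (lattice x) = lattice (x *m M).
Proof.
rewrite {1}/lattice raddfD /= !raddfMn phiA phiB -!latticeZ -raddfD /=.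
congr lattice; rewrite mulmx_sum_row !big_ord_recl big_ord0 addr0.
by have -> : lift ord0 ord0 = 1 :> 'I_2 by apply/val_inj.
Qed.

Lemma mulrn_gcdn (Q : G) m n : Q *+ m = 0 -> Q *+ n = 0 -> Q *+ gcdn m n = 0.
Proof.
have [->|m0] := posnP m; first by rewrite gcd0n.
move=> Qm Qn; case: (egcdnP n m0) => km kn E _.
have : Q *+ (km * m) = 0 by rewrite mulnC mulrnA Qm mul0rn.
by rewrite E mulrnDr mulnC mulrnA Qn mul0rn add0r.
Qed.

(** Fixed elements killed by [2 ^ r] are killed already by [2 ^ r.-1]. Applied to multiples of [Q],
    this lowers any exponent above [r] one step at a time. *)
Lemma fixed_torsion Q n : phi Q = Q -> Q *+ 2 ^ n = 0 -> Q *+ N = 0.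
Proof.
have base T : phi T = T -> T *+ N = 0 -> T *+ 2 ^ r.-1 = 0.
  move=> phiT TN; have [x Ex] := torsion_lattice (leqnn r) TN.
  have Hx : x *m (1%:M - M) = 0.
    apply: lattice_inj; rewrite mulmxBr mulmx1 raddfB /= -phi_lattice -Ex phiT.
    by rewrite subrr raddf0.
  have Td : T *+ \det (1%:M - M) = 0.
    (* The adjugate turns the matrix relation into annihilation by the determinant. *)
    have := congr1 (fun y => lattice (y *m \adj (1%:M - M))) Hx.
    by rewrite -mulmxA mul_mx_adj mul_mx_scalar mul0mx raddf0 latticeZ -Ex.
  have := mulrn_gcdn Td TN.
  have /(dvdn_pfactor _ _ (isT : prime 2)) := dvdn_gcdr (\det (1%:M - M)) N.
  case=> k kr Ek; rewrite Ek => Tk.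
  (* If [k = r], then [N] would divide the representative of the determinant, which is smaller than
     [N], making it 0. *)
  have {}kr : (k <= r.-1)%N.
    rewrite -ltnS prednK // ltn_neqAle kr andbT; apply: contraNneq det_neq0 => kr'.
    have : (N %| \det (1%:M - M))%N.
      by have := dvdn_gcdl (\det (1%:M - M)) N; rewrite Ek kr'.
    rewrite /dvdn modn_small; last by rewrite -[ltnRHS](Zp_cast N_gt1) ltn_ord.
    by move/eqP => H; apply/eqP/val_inj.
  by rewrite -(subnKC kr) expnD mulrnA Tk mul0rn.
move=> phiQ; elim: n => [|n IH] Qn.
  by move: Qn; rewrite expn0 mulr1n => ->; rewrite mul0rn.
have [nr|rn] := leqP n.+1 r.
  by rewrite /N -(subnKC nr) expnD mulrnA Qn mul0rn.
apply: IH; have rn' : (r <= n.+1)%N by exact: ltnW.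
have := base (Q *+ 2 ^ (n.+1 - r)); rewrite raddfMn phiQ -!mulrnA -!expnD.
rewrite subnK // => /(_ erefl Qn).
by rewrite -[r in (_ - r)%N](prednK r_gt0) subSS subnK // -ltnS prednK.
Qed.

Theorem odd_order_iff_image (P : G) h :
  beta *+ N = P -> (exists2 n, (0 < n)%N & P *+ n = 0) ->
  (exists2 n, odd n & P *+ 2 ^ h *+ n = 0) <->
  exists x : 'rV['Z_N]_2, x *m (1%:M - M) = (2 ^ h)%:R *: v.
Proof.
move=> beta_N P_fin; split=> [[n n_odd Pn]|[x Ex]].
  have phiP : phi P = P.
    by rewrite -beta_N raddfMn phi_beta mulrnDl lattice_torsion addr0.
  have n0 : (0 < n)%N by case: (n) n_odd.
  have cop : coprime N n by rewrite coprimeXl // coprime2n.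
  (* [c] is an inverse of [N] modulo the odd number [n]; multiplying by it produces a [phi]-fixed
     [N]-th part of [P *+ 2 ^ h]. *)
  have [c Pc] : exists c, P *+ 2 ^ h *+ c *+ N = P *+ 2 ^ h.
    case: (egcdnP n (expn_gt0 2 r : (0 < N)%N)) => c d E _; exists c.
    by rewrite -mulrnA E (eqP cop) addn1 mulrS [(d * n)%N]mulnC mulrnA Pn mul0rn addr0.
  have [x Ex] : exists x, P *+ 2 ^ h *+ c - beta *+ 2 ^ h = lattice x.
    apply: (torsion_lattice (leqnn r)).
    by rewrite mulrnBl Pc -/N -[beta *+ _ *+ _]mulrnA mulnC mulrnA beta_N subrr.
  have phix : phi (lattice x) = lattice x - lattice v *+ 2 ^ h.
    rewrite -Ex raddfB 3!raddfMn /= phiP phi_beta [(beta + _) *+ _]mulrnDl.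
    by rewrite opprD addrA.
  exists x; apply: lattice_inj; rewrite mulmxBr mulmx1 raddfB /= -phi_lattice phix.
  by rewrite subKr scaler_nat raddfMn.
pose Q := beta *+ 2 ^ h + lattice x.
have phiQ : phi Q = Q.
  rewrite raddfD raddfMn /= phi_beta phi_lattice mulrnDl -addrA -raddfMn -raddfD /=.
  by rewrite -scaler_nat -Ex mulmxBr mulmx1 subrK.
have QN : Q *+ N = P *+ 2 ^ h.
  by rewrite mulrnDl lattice_torsion addr0 -mulrnA mulnC mulrnA beta_N.
(* The odd part of [n] suffices: multiplied by it, [Q] is fixed by [phi] and killed by a power of 2,
   hence by [N]. *)
have [n n0 Pn] := P_fin; exists (n`_2^')%N; first by rewrite odd_2'nat part_pnat.
rewrite -QN -mulrnA mulnC mulrnA; apply: (@fixed_torsion _ (r + logn 2 n)).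
  by rewrite raddfMn phiQ.
rewrite -mulrnA expnD mulnCA mulrnA QN -/N -p_part mulnC partnC //.
by rewrite -mulrnA mulnC mulrnA Pn mul0rn.
Qed.

End TorsionLattice.

(** * Residue fields *)

Section PrimeFieldEmbedding.
Variables (p : nat) (k : fieldType) (pcharkp : p \in [pchar k]).

Definition prime_field_embed : 'F_p -> k := in_alg (pPrimeCharType pcharkp).

Lemma prime_field_embed_zmod : zmod_morphism prime_field_embed.
Proof. exact: (rmorphB (in_alg (pPrimeCharType pcharkp))). Qed.

Lemma prime_field_embed_monoid : monoid_morphism prime_field_embed.
Proof.
split; first exact: (rmorph1 (in_alg (pPrimeCharType pcharkp))).
exact: (rmorphM (in_alg (pPrimeCharType pcharkp))).
Qed.

HB.instance Definition _ :=
  GRing.isZmodMorphism.Build 'F_p k prime_field_embed prime_field_embed_zmod.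
HB.instance Definition _ :=
  GRing.isMonoidMorphism.Build 'F_p k prime_field_embed prime_field_embed_monoid.

End PrimeFieldEmbedding.

Section ResidueField.
Variables (D : comNzRingType) (I : prime_idealr D).

(* The library gives [D / I] no inverses, which [{fraction _}] requires. *)
Definition residue_domain : Type := {ideal_quot I}.
HB.instance Definition _ := GRing.ComNzRing.on residue_domain.
Implicit Types x y : residue_domain.

Definition residue_unit : {pred residue_domain} :=
  fun x => `[< exists y, y * x = 1 >].
Definition residue_inv x : residue_domain :=
  if pselect (exists y, y * x = 1) is left e then projT1 (cid e) else x.

Lemma residue_mulVx : {in residue_unit, left_inverse 1 residue_inv *%R}.
Proof.
move=> x /asboolP e; rewrite /residue_inv; case: pselect => // e'.
exact: projT2 (cid e').
Qed.

Lemma residue_unitP x y : y * x = 1 -> residue_unit x.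
Proof. by move=> e; apply/asboolP; exists y. Qed.

Lemma residue_inv_out : {in [predC residue_unit], residue_inv =1 id}.
Proof.
move=> x /asboolPn nu; rewrite /residue_inv; case: pselect => // e.
Qed.

HB.instance Definition _ := GRing.ComNzRing_hasMulInverse.Build residue_domain
  residue_mulVx residue_unitP residue_inv_out.

Lemma residue_integral : GRing.integral_domain_axiom residue_domain.
Proof. by move=> x y; exact: Quotient.rquot_IdomainAxiom. Qed.

HB.instance Definition _ :=
  GRing.ComUnitRing_isIntegral.Build residue_domain residue_integral.

(** Primality of [I] makes the quotient a domain, so it embeds in its fraction field. *)
Definition residue_field : fieldType := {fraction residue_domain}.

Definition residue (d : D) : residue_field :=
  tofrac (\pi_({ideal_quot I})%qT d : residue_domain).

Lemma residue_zmod : zmod_morphism residue.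
Proof.
move=> x y; rewrite /residue -tofracB; congr tofrac.
exact: (raddfB (\pi_({ideal_quot I})%qT : {additive D -> {ideal_quot I}})).
Qed.

Lemma residue_monoid : monoid_morphism residue.
Proof.
split.
  apply: etrans (tofrac1 _); congr tofrac.
  exact: (rmorph1 (\pi_({ideal_quot I})%qT : {rmorphism D -> {ideal_quot I}})).
move=> x y; rewrite /residue -tofracM; congr tofrac.
exact: (rmorphM (\pi_({ideal_quot I})%qT : {rmorphism D -> {ideal_quot I}})).
Qed.

HB.instance Definition _ :=
  GRing.isZmodMorphism.Build D residue_field residue residue_zmod.
HB.instance Definition _ :=
  GRing.isMonoidMorphism.Build D residue_field residue residue_monoid.

Lemma residue_eq0 d : (residue d == 0) = (d \in I).
Proof.
rewrite /residue tofrac_eq0 -{2}[d]subr0 Quotient.idealrBE.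
congr (_ == _); apply/esym.
exact: (raddf0 (\pi_({ideal_quot I})%qT : {additive D -> {ideal_quot I}})).
Qed.

End ResidueField.

Section PointMap.
Variables (F G : fieldType) (f : {rmorphism F -> G}).
Variables (chF : nonsingular_char F) (chG : nonsingular_char G).

Definition point_map (Q : point chF) : point chG :=
  mkpoint chG ((map_point_on_curve f _).2 (point_on_curve Q)).

Lemma point_map_zmod_morphism : zmod_morphism point_map.
Proof.
have mapD Q Q' : point_map (Q + Q') = point_map Q + point_map Q'.
  by apply: val_inj; exact: map_point_addp.
by move=> Q Q'; have := mapD (Q - Q') Q'; rewrite subrK => ->; rewrite addrK.
Qed.

HB.instance Definition _ := GRing.isZmodMorphism.Build (point chF) (point chG)
  point_map point_map_zmod_morphism.

Lemma point_map_inj : injective point_map.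
Proof.
by move=> Q Q' /(congr1 (@point_val _ _)) /map_point_inj H; apply: val_inj.
Qed.

Lemma point_map_P : point_map (point_P chF) = point_P chG.
Proof. by apply: val_inj; exact: map_point_P. Qed.

End PointMap.

Lemma spec_point_mul_two_power (D : comNzRingType) (K k : fieldType)
    (i : {rmorphism D -> K}) (f : {rmorphism D -> k}) (i_inj : injective i)
    (D_closed : forall z (c3 c2 c1 c0 : D),
      z ^+ 4 + i c3 * z ^+ 3 + i c2 * z ^+ 2 + i c1 * z + i c0 = 0 ->
      exists d, z = i d)
    (chK : nonsingular_char K) (chk : nonsingular_char k)
    (Q : point chK) (q : point chk) n :
  spec_point i f (point_val Q) (point_val q) ->
  spec_point i f (point_val (Q *+ 2 ^ n)) (point_val (q *+ 2 ^ n)).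
Proof.
move=> H; elim: n => [|n IH]; first by rewrite !expn0 !mulr1n.
rewrite expnS mulnC !mulrnA !mulr2n; apply: spec_point_double => //.
exact: point_on_curve.
Qed.

(** Pigeonhole on the multiples of [Q]. *)
Lemma finite_order (F : finFieldType) (chF : nonsingular_char F) (Q : point chF) :
  exists2 n, (0 < n)%N & Q *+ n = 0.
Proof.
pose g (j : 'I_(#|{: option (F * F)}|.+1)) := point_val (Q *+ j).
have /injectivePn [j1 [j2 j12 E]] : ~~ injectiveb g.
  apply/negP => /injectiveP g_inj; have := leq_card g g_inj.
  by rewrite card_ord ltnn.
have {}E : Q *+ j1 = Q *+ j2 by exact: val_inj.
wlog lt12 : j1 j2 j12 E / (j1 < j2)%N.
  move=> H; have [/H|/H|/val_inj j12'] := ltngtP j1 j2; first exact.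
    by apply; rewrite // eq_sym.
  by rewrite j12' eqxx in j12.
exists (j2 - j1)%N; first by rewrite subn_gt0.
by rewrite mulrnBr ?(ltnW lt12) // E subrr.
Qed.

Lemma nonsingular_char_rat : nonsingular_char rat.
Proof. by rewrite /nonsingular_char pnatr_eq0. Qed.

Lemma nonsingular_char_p (p : nat) (k : fieldType) : prime p ->
  p \notin [:: 2; 3; 17]%N -> p \in [pchar k] -> nonsingular_char k.
Proof.
move=> p_pr p_good ch; rewrite /nonsingular_char -(dvdn_pcharf ch).
move: p_good; rewrite -[102%N]/(2 * (3 * 17))%N !Euclid_dvdM //.
by rewrite !dvdn_prime2 // !inE.
Qed.

(** * Reduction of rational points modulo p *)

Section RationalReduction.
Variables (p : nat) (p_prime : prime p).

Let intr_Fp_eq0 (z : int) : (z%:~R == 0 :> 'F_p) = (p %| `|z|)%N.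
Proof.
rewrite (dvdn_pcharf (pchar_Fp p_prime)); case: z => n //=.
by rewrite NegzE rmorphN oppr_eq0.
Qed.

(** The rational root theorem: the denominator divides the fourth power of the numerator, to which
    it is coprime. *)
Lemma rat_int_closed (z : rat) (c3 c2 c1 c0 : int) :
  z ^+ 4 + c3%:~R * z ^+ 3 + c2%:~R * z ^+ 2 + c1%:~R * z + c0%:~R = 0 ->
  exists d : int, z = d%:~R.
Proof.
move=> H; set n := numq z; set d := denq z.
have E : n ^+ 4 = - (c3 * n ^+ 3 + c2 * n ^+ 2 * d + c1 * n * d ^+ 2 + c0 * d ^+ 3) * d.
  apply: (@intr_inj rat); rewrite !(rmorphM, rmorphN, rmorphD, rmorphXn) /= /n numqE -/d.
  by apply: (eq_of_lin (k := d%:~R ^+ 4) H); ring.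
have : (`|d| %| `|n| ^ 4)%N by rewrite -abszX E abszM dvdn_mull.
have cop : coprime `|d| (`|n| ^ 4) by rewrite coprimeXr // coprime_sym coprime_num_den.
move=> dn; have d1 : `|d|%N = 1%N by apply/eqP; rewrite -dvdn1 -(eqP cop) dvdn_gcd dvdnn.
exists n; rewrite /n numqE -/d.
have -> : d = 1 by rewrite -[d]gez0_abs ?d1 // ltW // denq_gt0.
by rewrite mulr1.
Qed.

Local Notation int_rat := (intr : {rmorphism int -> rat}).
Local Notation int_Fp := (intr : {rmorphism int -> 'F_p}).
Local Notation spec := (spec int_rat int_Fp).
Local Notation integral := (integral int_rat int_Fp).

Lemma spec_ratr (z : rat) : ~~ (p %| `|denq z|)%N -> spec z (ratr z).
Proof.
move=> pz; have d0 : (denq z)%:~R != 0 :> 'F_p by rewrite intr_Fp_eq0.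
by exists (numq z), (denq z); split=> //=; [rewrite numqE | rewrite /ratr mulfVK].
Qed.

Lemma integral_denq (z : rat) : integral z -> ~~ (p %| `|denq z|)%N.
Proof.
case=> w [a [b [b0 E _]]]; apply: contra b0 => pz; rewrite /= intr_Fp_eq0.
have {}E : numq z * b = a * denq z.
  apply: (@intr_inj rat); rewrite !rmorphM /= numqE -E; ring.
have : (p %| `|numq z| * `|b|)%N by rewrite -abszM E abszM dvdn_mull.
rewrite Euclid_dvdM // => /orP[pn|//].
have : (p %| gcdn `|numq z| `|denq z|)%N by rewrite dvdn_gcd pn.
by rewrite (eqP (coprime_num_den z)) dvdn1 => /eqP p1; move: p_prime; rewrite p1.
Qed.

(** An integral abscissa forces an integral ordinate, so either divisibility tested by [redp] means
    a nonintegral abscissa. *)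
Lemma spec_redp (Q : Epoint rat) : on_curve Q ->
  spec_point int_rat int_Fp Q (redp p Q).
Proof.
case: Q => [[x y]|] // C; rewrite /redp !dvdzE /=.
case: ifPn => [|]; last first.
  by rewrite negb_or => /andP[px py]; split; exact: spec_ratr.
move=> pxy Ix; have Iy := integral_ordinate rat_int_closed C Ix.
by move: pxy; rewrite (negPf (integral_denq Ix)) (negPf (integral_denq Iy)).
Qed.

Hypothesis p_good : p \notin [:: 2; 3; 17]%N.

(** Both sides specialize the same rational point: the left by [spec_redp], the right by repeated
    doubling. *)
Lemma redp_mul_two_power h :
  redp p (mulp (2 ^ h) (ptP rat)) = mulp (2 ^ h) (ptP 'F_p).
Proof.
have chp := nonsingular_char_p p_prime p_good (pchar_Fp p_prime).
have C := point_on_curve (point_P nonsingular_char_rat *+ 2 ^ h).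
have := spec_point_mul_two_power (@intr_inj rat) rat_int_closed
  (Q := point_P nonsingular_char_rat) (q := point_P chp) h
  (conj (spec_nat _ _ 2) (spec_nat _ _ 2)).
have := spec_redp C; rewrite !point_valMn.
by move=> H1 H2; apply: (spec_point_unique (@intr_inj rat) H1 (H2 _)).
Qed.

End RationalReduction.

(** * Reduction at a prime of the division field *)

Section NumberField.
Variables (R : realType) (r : nat).
Local Notation K := (Kr R r).
Local Notation D := (OKr R r).
Let val_K : {rmorphism K -> R[i]} := \val.
Let val_D : {rmorphism D -> K} := \val.
Let val_D_inj : injective val_D := val_inj.

Lemma nonsingular_char_Kr : nonsingular_char K.
Proof.
rewrite /nonsingular_char -(inj_eq (fmorph_inj val_K)) rmorph_nat rmorph0.
by rewrite pnatr_eq0.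
Qed.

(** Transitivity of integrality over the integers. *)
Lemma OKr_closed (z : K) (c3 c2 c1 c0 : D) :
  z ^+ 4 + val_D c3 * z ^+ 3 + val_D c2 * z ^+ 2 + val_D c1 * z + val_D c0 = 0 ->
  exists d, z = val_D d.
Proof.
move=> H; suff Iz : in_OKr z by exists (MkOKr Iz).
pose s := [:: val_D c0; val_D c1; val_D c2; val_D c3; 1].
have sE : Poly s = s :> seq K by rewrite (PolyK (c := 0)) //= oner_neq0.
apply/asboolP; apply: (@integral_root_monic _ _ (intr : {rmorphism int -> K}) z (Poly s)).
- by rewrite monicE lead_coefE sE.
- rewrite /root horner_Poly -H /s; apply/eqP.
  by move: (val_D c0) (val_D c1) (val_D c2) (val_D c3) => d0 d1 d2 d3 /=; ring.
move=> c; rewrite sE !inE.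
have ID (d : D) : integralOver (intr : {rmorphism int -> K}) (val_D d).
  exact/asboolP/(OKr_valP d).
case/or4P=> [/eqP->|/eqP->|/eqP->|/orP[] /eqP ->]; do ?[exact: ID].
exact: integral1.
Qed.

Variables (p : nat) (p_prime : prime p) (I : prime_idealr D).
Hypothesis I_above : above p I.
Local Notation k := (residue_field I).
Let f : {rmorphism D -> k} := @residue D I.

Lemma residue_pchar : p \in [pchar k].
Proof.
by rewrite inE p_prime /= -(rmorph_nat f) residue_eq0.
Qed.

Variable sigma : galKr R r.
Hypothesis sigma_frob : is_frobenius p I sigma.
Let phi : {rmorphism k -> k} := pFrobenius_aut residue_pchar.

(** On [OKr] this is the Frobenius congruence. It passes to quotients because the image of a
    denominator is raised to the power p and stays nonzero. *)
Lemma spec_frobenius (z : K) w : spec val_D f z w -> spec val_D f (sigma z) (phi w).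
Proof.
have frob d : f (gal_OKr sigma d) = phi (f d).
  rewrite /phi /= pFrobenius_autE; apply/eqP; rewrite -rmorphXn -subr_eq0 -rmorphB.
  by rewrite residue_eq0; exact: sigma_frob.
case=> a [b [b0 E F]]; exists (gal_OKr sigma a), (gal_OKr sigma b); split.
- by rewrite frob fmorph_eq0.
- by have /= := congr1 sigma E; rewrite rmorphM.
- by rewrite !frob -rmorphM F.
Qed.

Variable chk : nonsingular_char k.
Let chK := nonsingular_char_Kr.

Lemma reduces_frobenius (Q : point chK) (q : point chk) :
  reduces val_D f Q q ->
  reduces val_D f (point_map sigma chK Q) (point_map phi chk q).
Proof.
case: Q q => [[[x y]|] C] [[[x' y']|] c] [/= IQ HQ] //.
case: HQ => Hx Hy; split; last by split; exact: spec_frobenius.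
by exists (phi x'); exact: spec_frobenius.
Qed.

Lemma reduces_two_power_torsion (n : nat) (Q : point chK) :
  Q *+ 2 ^ n = 0 -> exists q : point chk, reduces val_D f Q q.
Proof.
move=> Qn; have I0 : integral_point val_D f (point_val (Q *+ 2 ^ n)) by rewrite Qn.
apply: (reduces_exists val_D_inj OKr_closed).
exact: (integral_two_power_division val_D_inj OKr_closed chk I0).
Qed.

End NumberField.

(** * Transfer from complex points to the residue field and back to ['F_p] *)

Theorem theorem4p1 (R : realType) (r : nat) (r_ge1 : (1 <= r)%N)
    (A B beta : Epoint R[i])
    (AB_basis : torsion_basis (2 ^ r) A B)
    (beta_div : division_point r beta)
    (p : nat) (p_prime : prime p) (p_good : p \notin [:: 2; 3; 17]%N)
    (I : prime_idealr (OKr R r)) (I_above : above p I)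
    (sigma : galKr R r) (sigma_frob : is_frobenius p I sigma)
    (M : 'M['Z_(2 ^ r)]_2) (v : 'rV['Z_(2 ^ r)]_2)
    (sigma_A : gal_maps sigma A (lincomb (M 0 0) (M 0 1) A B))
    (sigma_B : gal_maps sigma B (lincomb (M 1 0) (M 1 1) A B))
    (sigma_beta :
       gal_maps sigma beta (addp beta (lincomb (v 0 0) (v 0 1) A B)))
    (det_neq0 : \det (1%:M - M) != 0)
    (h : nat) :
  has_odd_order (redp p (mulp (2 ^ h) (ptP rat))) <->
  exists x : 'rV['Z_(2 ^ r)]_2, x *m (1%:M - M) = (2 ^ h)%:R *: v.
Proof.
pose iK : {rmorphism Kr R r -> R[i]} := \val.
pose iD : {rmorphism OKr R r -> Kr R r} := \val.
have iD_inj : injective iD := val_inj.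
have iK_inj := map_point_inj (f := iK).
pose chK := nonsingular_char_Kr R r.
have chp := nonsingular_char_p p_prime p_good (pchar_Fp p_prime).
have charkp := residue_pchar p_prime I_above.
have chk := nonsingular_char_p p_prime p_good charkp.
(* The primed points are models over [Kr] of the complex points, on which [sigma] acts. *)
case: sigma_A => A' EA SA; case: sigma_B => B' EB SB; case: sigma_beta => b' Eb Sb.
have [[CA TA] [CB TB] basis] := AB_basis; have [Cb Tb] := beta_div.
rewrite -[map_point _ _]/(map_point iK _) in EA.
rewrite -[map_point _ _]/(map_point iK _) in EB.
rewrite -[map_point _ _]/(map_point iK _) in Eb.
have mapS T :
    map_point (fun z => Kr_val (sigma z)) T = map_point iK (map_point sigma T).
  by case: T => [[x y]|].
rewrite -EA -EB -?Eb mapS -?map_point_lincomb -?map_point_addp in SA SB Sb.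
rewrite mapS in SB; rewrite mapS in Sb.
move/iK_inj: SA => SA; move/iK_inj: SB => SB; move/iK_inj: Sb => Sb.
have CA' : on_curve A' by apply/(map_point_on_curve iK); rewrite EA.
have CB' : on_curve B' by apply/(map_point_on_curve iK); rewrite EB.
have Cb' : on_curve b' by apply/(map_point_on_curve iK); rewrite Eb.
pose a := mkpoint chK CA'; pose b := mkpoint chK CB'; pose be := mkpoint chK Cb'.
have aN : a *+ 2 ^ r = 0.
  apply: val_inj; apply: etrans (point_valMn _ _) _; apply: iK_inj.
  by rewrite map_point_mulp EA TA.
have bN : b *+ 2 ^ r = 0.
  apply: val_inj; apply: etrans (point_valMn _ _) _; apply: iK_inj.
  by rewrite map_point_mulp EB TB.
have beN : be *+ 2 ^ r = point_P chK.
  apply: val_inj; apply: etrans (point_valMn _ _) _; apply: iK_inj.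
  by rewrite map_point_mulp Eb Tb map_point_P.
pose lat := lattice (r := r) a b.
have valL x : point_val (lat x) = lincomb (x 0 0) (x 0 1) A' B'.
  exact: point_val_lincomb.
pose ps := @point_map _ _ sigma chK chK.
have psA : ps a = lat (row 0 M).
  by apply: val_inj; rewrite [RHS]valL !mxE.
have psB : ps b = lat (row 1 M).
  by apply: val_inj; rewrite [RHS]valL !mxE.
have psb : ps be = be + lat v.
  by apply: val_inj; apply: etrans Sb _; rewrite -valL.
(* The uniqueness part of [torsion_basis], pulled back from the complex points. *)
have lat_inj : injective lat.
  move=> x y E; have tor : torsion (2 ^ r) (map_point iK (point_val (lat x))).
    split; first exact/(map_point_on_curve iK)/point_on_curve.
    by rewrite -map_point_mulp -point_valMn (lattice_torsion r_ge1).
  have [c [_ Hc]] := basis _ tor.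
  have /Hc Ex : map_point iK (point_val (lat x)) =
      lincomb (x 0 0, x 0 1).1 (x 0 0, x 0 1).2 A B.
    by rewrite valL map_point_lincomb EA EB.
  have /Hc Ey : map_point iK (point_val (lat x)) =
      lincomb (y 0 0, y 0 1).1 (y 0 0, y 0 1).2 A B.
    by rewrite E valL map_point_lincomb EA EB.
  move: Ey; rewrite Ex => -[E0 E1]; apply/rowP => -[[|[|//]] j2].
    by rewrite (_ : Ordinal j2 = 0) //; apply: val_inj.
  by rewrite (_ : Ordinal j2 = 1) //; apply: val_inj.
pose red := @reduces _ _ _ iD (@residue _ I) chk chK.
have red_uniq Q q q' : red Q q -> red Q q' -> q = q' by exact: reduces_unique.
(* A sum of integral points may fail to be integral, so a reduction of the sum is requested; torsion
   points and division points of P always have one. *)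
have red_add Q Q' q q' : (exists q, red (Q + Q') q) -> red Q q -> red Q' q' ->
    red (Q + Q') (q + q').
  by case=> s [IQ _]; exact: (reducesD iD_inj (@OKr_closed R r)).
have red_tor Q : Q *+ 2 ^ r = 0 -> exists q, red Q q.
  exact: reduces_two_power_torsion.
have red_mul Q q n : Q *+ 2 ^ r = 0 -> red Q q -> red (Q *+ n) (q *+ n).
  move=> QN Hq; elim: n => [|n IH]; first exact: reduces0.
  rewrite !mulrS; apply: red_add => //; apply: red_tor.
  by rewrite -mulrS -mulrnA mulnC mulrnA QN mul0rn.
have red_mul0 Q q : Q *+ 2 ^ r = 0 -> red Q q -> q *+ 2 ^ r = 0.
  move=> QN Hq; apply: (red_uniq 0); last exact: reduces0.
  by rewrite -QN; exact: red_mul.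
have [a1 Ra] := red_tor a aN; have [b1 Rb] := red_tor b bN.
have a1N := red_mul0 _ _ aN Ra; have b1N := red_mul0 _ _ bN Rb.
have latN x : lat x *+ 2 ^ r = 0 by exact: lattice_torsion.
pose lat1 := lattice (r := r) a1 b1.
have red_lat x : red (lat x) (lat1 x).
  by apply: red_add; [exact/red_tor/latN | exact: red_mul | exact: red_mul].
(* A difference in the kernel is an integral point reducing to 0, hence 0. *)
have lat1_inj : injective lat1.
  move=> x y E; apply: lat_inj; apply/eqP; rewrite -subr_eq0; apply/eqP.
  have latB := lattice_zmod_morphism r_ge1 aN bN x y.
  have lat1B := lattice_zmod_morphism r_ge1 a1N b1N x y.
  rewrite -/lat -/lat1 in latB lat1B.
  apply: (reduces_eq0 (i := iD) (f := @residue _ I) (chk := chk)); rewrite -latB.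
  by have := red_lat (x - y); rewrite lat1B E subrr.
have int_beta (Q : point chK) : Q *+ 2 ^ r = point_P chK -> exists q, red Q q.
  move=> QN; apply: (reduces_exists iD_inj (@OKr_closed R r)).
  apply: (integral_two_power_division iD_inj (@OKr_closed R r) chk (n := r)).
  by rewrite QN; exists 2%:R; exact: spec_nat.
have [be1 Rbe] := int_beta be beN.
have be1N : be1 *+ 2 ^ r = point_P chk.
  apply: val_inj; apply: (spec_point_unique iD_inj).
    exact: (spec_point_mul_two_power iD_inj (@OKr_closed R r) r Rbe.2).
  by rewrite beN; split; exact: spec_nat.
pose phi := @point_map _ _ (pFrobenius_aut charkp) chk chk.
have red_frob Q q : red Q q -> red (ps Q) (phi q) by exact: reduces_frobenius.
have phiA : phi a1 = lat1 (row 0 M).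
  by apply: (red_uniq (ps a)); [exact: red_frob | rewrite psA].
have phiB : phi b1 = lat1 (row 1 M).
  by apply: (red_uniq (ps b)); [exact: red_frob | rewrite psB].
have phib : phi be1 = be1 + lat1 v.
  apply: (red_uniq (ps be)); first exact: red_frob.
  (* [be + lat v] is again a division point of P, hence integral. *)
  rewrite psb; apply: red_add => //; apply: int_beta.
  by rewrite mulrnDl latN addr0.
(* This injection carries the question about odd multiples from the curve over ['F_p] to the one
   over the residue field. *)
pose g : {additive point chp -> point chk} :=
  @point_map _ _ (prime_field_embed charkp) chp chk.
have gP : g (point_P chp) = point_P chk by exact: point_map_P.
(* P is defined over the finite field ['F_p], so its image over the residue field has finite
   order. *)
have [n n0 Pn] := finite_order (point_P chp).
have Pfin : exists2 n, (0 < n)%N & point_P chk *+ n = 0.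
  by exists n => //; rewrite -gP -raddfMn Pn raddf0.
rewrite (redp_mul_two_power p_prime p_good).
have := mulp_odd_orderP (point_P chp *+ 2 ^ h); rewrite point_valMn => ->.
rewrite -(odd_order_iff_image r_ge1 a1N b1N lat1_inj (two_torsion_cover (charF := chk))
  (phi := phi) phiA phiB phib det_neq0 h be1N Pfin).
have gM m : g (point_P chp *+ 2 ^ h *+ m) = point_P chk *+ 2 ^ h *+ m.
  by rewrite !raddfMn gP.
split=> -[m m_odd Hm]; exists m => //; first by rewrite -gM Hm raddf0.
apply: (point_map_inj (chG := chk) (f := prime_field_embed charkp)).
by rewrite [LHS]gM Hm raddf0.
Qed.
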